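(* Let $d\ge 1$ be an integer. For every mass distribution $\mu$ in $\mathbb{R}^d$ there exist a collection of $2d-2$ parallel hyperplanes and one additional hyperplane, not parallel to them, which together divide $\mathbb{R}^d$ into $4d-2=(2d-1)\times 2$ boxes all containing the same amount of the mass distribution (that is, each box has $\mu$-measure $\frac{1}{4d-2}\,\mu(\mathbb{R}^d)$).
   Context: A mass distribution in $\mathbb{R}^d$ is a finite Borel measure $\mu$ of the form $\mu(A)=\int_A f\,dx$ for an integrable density function $f:\mathbb{R}^d\to\mathbb{R}$ (integration with respect to Lebesgue measure), such that every nonempty open subset of $\mathbb{R}^d$ has positive $\mu$-measure. Boxes: a collection of $l$ parallel hyperplanes divides $\mathbb{R}^d$ into $l+1$ consecutive regions, and one additional hyperplane not parallel to them divides $\mathbb{R}^d$ into two half-spaces; the boxes are the $2(l+1)$ intersections of one of the $l+1$ regions with one of the two half-spaces. *)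

(* Defs.v *)
From HB Require Import structures.
From mathcomp Require Import all_boot all_order all_algebra.
From mathcomp Require Import all_classical all_reals all_analysis.
From mathcomp Require Import measurable_realfun.

Set Implicit Arguments.
Unset Strict Implicit.
Unset Printing Implicit Defensive.

Import Order.TTheory GRing.Theory Num.Theory.
Import numFieldNormedType.Exports.

Local Open Scope classical_set_scope.
Local Open Scope ring_scope.

(* Borel R^n, with R^n represented by row vectors. *)
Definition borelRn (R : realType) (n : nat) :=
  g_sigma_algebraType (@open 'rV[R]_n).

Section borelRn_measurability.
Context (R : realType).

Lemma measurable_coord n (i : 'I_n) :
  measurable_fun [set: borelRn R n]
    (fun x : borelRn R n => x ord0 i : measurableTypeR R).
Proof.
apply: (measurability _ (RGenOInfty.measurableE R)).
move=> _ [_ [a ->] <-].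
rewrite setTI; apply: sub_sigma_algebra => /=.
apply: (@open_comp _ _ (fun x : 'rV[R]_n => x ord0 i)).
  by move=> x _; exact: coord_continuous.
exact: interval_open.
Qed.

Lemma measurable_fun_borelRn d (T : measurableType d) n (f : T -> borelRn R n) :
  (forall i : 'I_n,
    measurable_fun [set: T] (fun x => f x ord0 i : measurableTypeR R)) ->
  measurable_fun [set: T] f.
Proof.
move=> mf; apply: (@measurability _ _ T (borelRn R n) setT f (@open 'rV[R]_n)) => // _ [U oU <-]; rewrite setTI.
pose box (q : {ffun 'I_n -> rat * rat}) : set 'rV[R]_n :=
  [set x | forall i, ratr (q i).1 < x ord0 i < ratr (q i).2].
pose good q := `[< box q `<=` U >].
have -> : f @^-1` U = \bigcup_(q : {ffun 'I_n -> rat * rat})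
    (if good q then f @^-1` box q else set0).
  apply/seteqP; split=> [x Ux|x [q _]]; last first.
    by case: ifPn => // /asboolP qU fx; exact: qU.
  have /nbhs_ballP[e /= e0 eU] : nbhs (f x : 'rV[R]_n) U by exact: open_nbhs_nbhs.
  have /choice[q qP] (i : 'I_n) : exists pr : rat * rat,
      [/\ f x ord0 i - e < ratr pr.1 < f x ord0 i
        & f x ord0 i < ratr pr.2 < f x ord0 i + e].
    have /rat_in_itvoo[p] : f x ord0 i - e < f x ord0 i by rewrite ltrBlDr ltrDl.
    have /rat_in_itvoo[r] : f x ord0 i < f x ord0 i + e by rewrite ltrDl.
    by rewrite !in_itv/= => ? ?; exists (p, r).
  exists [ffun i => q i] => //; rewrite ifT.
    by move=> i; rewrite ffunE; have [/andP[_ ->] /andP[->]] := qP i.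
  apply/asboolP => y qy; apply: eU; split=> // i0 i; rewrite (ord1 i0).
  have := qy i; rewrite ffunE; have [/andP[h1 h2] /andP[h3 h4]] := qP i.
  move=> /andP[h5 h6]; rewrite /ball/= ltr_distlC.
  by rewrite (lt_trans h1 h5) (lt_trans h6 h4).
apply: countable_bigcupT_measurable => [|q]; first exact: countableP.
case: ifPn => // _.
have -> : f @^-1` box q = \bigcap_(i in [set: 'I_n])
    ((fun x => f x ord0 i) @^-1` `]ratr (q i).1, ratr (q i).2[).
  by apply/seteqP; split=> [x h i _|x h i]; have /= := h i; rewrite in_itv/=; exact.
apply: fin_bigcap_measurable => // i _.
rewrite -[X in measurable X]setTI; apply: mf => //.
Qed.

End borelRn_measurability.

(* Lebesgue measure on R^n is built by recursion on n, as the image under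
   (a, x) |-> (a, x_1, ..., x_n) of the product of the one-dimensional Lebesgue
   measure and the measure on R^n; R^0 carries the unit mass. The lemma
   lebesgue_Rn_box gives its value on products of Borel sets. *)
Section lebesgue_Rn.
Context (R : realType).

Definition consRn n (p : measurableTypeR R * borelRn R n) : borelRn R n.+1 :=
  row_mx (p.1%:M : 'rV[R]_1) (p.2 : 'rV[R]_n).

Definition unconsRn n (x : borelRn R n.+1) : measurableTypeR R * borelRn R n :=
  (x ord0 ord0, rsubmx (x : 'rV[R]_(1 + n))).

Lemma consRn0 n p : @consRn n p ord0 ord0 = p.1.
Proof.
have := row_mxEl (p.1%:M : 'rV[R]_1) (p.2 : 'rV[R]_n) ord0 ord0.
rewrite [RHS]mxE mulr1n => <-; congr (fun_of_matrix _ _ _); exact: val_inj.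
Qed.

Lemma consRnS n p (i : 'I_n) : @consRn n p ord0 (lift ord0 i) = p.2 ord0 i.
Proof.
rewrite -(row_mxEr (p.1%:M : 'rV[R]_1) (p.2 : 'rV[R]_n) ord0 i).
congr (fun_of_matrix _ _ _); exact: val_inj.
Qed.

Lemma consRnK n : cancel (@consRn n) (@unconsRn n).
Proof.
move=> [a x]; rewrite /unconsRn consRn0; congr pair.
by rewrite /consRn row_mxKr.
Qed.

Lemma measurable_consRn n : measurable_fun setT (@consRn n).
Proof.
apply: measurable_fun_borelRn => i; case: (unliftP ord0 i) => [j ->|->].
  under eq_fun do rewrite consRnS.
  exact: (measurableT_comp (measurable_coord j) measurable_snd).
under eq_fun do rewrite consRn0.
exact: measurable_fst.
Qed.

Lemma measurable_unconsRn n : measurable_fun setT (@unconsRn n).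
Proof.
apply: measurable_fun_pair; first exact: measurable_coord.
apply: measurable_fun_borelRn => i.
rewrite (_ : (fun _ => _) = fun x : borelRn R n.+1 => x ord0 (rshift 1 i)).
  exact: measurable_coord.
by apply/funext => x; rewrite /= mxE.
Qed.

Section lebesgue_Rn_step.
Local Open Scope ereal_scope.
Context (n : nat) (m : {sigma_finite_measure set (borelRn R n) -> \bar R}).

HB.instance Definition _ :=
  isMeasurableFun.Build _ _ _ _ (@consRn n) (@measurable_consRn n).

Definition lebesgue_Rn_step : set (borelRn R n.+1) -> \bar R :=
  pushforward (lebesgue_measure \x m) (@consRn n).

Let step0 : lebesgue_Rn_step set0 = 0.
Proof. exact: measure0. Qed.

Let step_ge0 A : 0 <= lebesgue_Rn_step A.
Proof. exact: measure_ge0. Qed.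

Let step_sigma_additive : semi_sigma_additive lebesgue_Rn_step.
Proof. exact: measure_semi_sigma_additive. Qed.

HB.instance Definition _ := isMeasure.Build _ _ _ lebesgue_Rn_step
  step0 step_ge0 step_sigma_additive.

Let step_sigma_finite : sigma_finite setT lebesgue_Rn_step.
Proof.
have /sigma_finiteP[F [TF ndF Foo]] := sigma_finiteT (@lebesgue_measure R).
have /sigma_finiteP[G [TG ndG Goo]] := sigma_finiteT m.
exists (fun k => @unconsRn n @^-1` (F k `*` G k)).
  apply/esym; rewrite -preimage_bigcup -subTset => x _.
  have [i _ Fi] : (\bigcup_i F i) (unconsRn x).1 by rewrite -TF.
  have [j _ Gj] : (\bigcup_i G i) (unconsRn x).2 by rewrite -TG.
  exists (maxn i j) => //; split.
    by apply: subsetPset (unconsRn x).1 Fi; exact/ndF/leq_maxl.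
  by apply: subsetPset (unconsRn x).2 Gj; exact/ndG/leq_maxr.
move=> k; have [mF Fk] := Foo k; have [mG Gk] := Goo k; split.
  by rewrite -[X in measurable X]setTI; apply: measurable_unconsRn => //;
    exact: measurableX.
rewrite /lebesgue_Rn_step /pushforward -comp_preimage.
rewrite (_ : _ \o _ = id); last by apply/funext => x; exact: consRnK.
by rewrite preimage_id product_measure1E// lte_mul_pinfty// ge0_fin_numE.
Qed.

HB.instance Definition _ := Measure_isSigmaFinite.Build _ _ _ lebesgue_Rn_step
  step_sigma_finite.

End lebesgue_Rn_step.

Fixpoint lebesgue_Rn n : {sigma_finite_measure set (borelRn R n) -> \bar R} :=
  match n with
  | 0 => \d_(0 : borelRn R 0)
  | n'.+1 => lebesgue_Rn_step (lebesgue_Rn n')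
  end.

Lemma lebesgue_Rn_box n (A : 'I_n -> set R) :
  (forall i, measurable (A i)) ->
  lebesgue_Rn n [set x : borelRn R n | forall i, A i (x ord0 i)] =
  (\prod_(i < n) lebesgue_measure (A i))%E.
Proof.
elim: n A => [A mA|n IH A mA] /=.
  rewrite big_ord0 diracE mem_set//.
  by case.
rewrite big_ord_recl -IH; last by move=> i; exact: mA.
rewrite /lebesgue_Rn_step /pushforward /= -product_measure1E//; last first.
  rewrite (_ : [set _ | _] = \bigcap_(i in [set: 'I_n])
      ((fun x : borelRn R n => x ord0 i) @^-1` A (lift ord0 i))).
    apply: fin_bigcap_measurable => // i _.
    by rewrite -[X in measurable X]setTI; apply: measurable_coord => //; exact: mA.
  by apply/seteqP; split=> [x h i _|x h i]; [exact: h|exact: (h i)].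
  exact: mA.
congr (_ _); apply/seteqP; split=> x /=.
  move=> h; split; first by rewrite -consRn0.
  by move=> i /=; rewrite -consRnS.
move=> [/= h0 h] i; case: (unliftP ord0 i) => [j ->|->].
  by rewrite consRnS; exact: h.
by rewrite consRn0.
Qed.

End lebesgue_Rn.

Definition mass_distribution (R : realType) (d : nat)
    (mu : {finite_measure set (borelRn R d) -> \bar R}) : Prop :=
  (exists f : borelRn R d -> R,
    (lebesgue_Rn R d).-integrable setT (EFin \o f) /\
    forall A : set (borelRn R d), measurable A ->
      mu A = (\int[lebesgue_Rn R d]_(x in A) (f x)%:E)%E) /\
  forall U : set 'rV[R]_d, open U -> U !=set0 -> (0 < mu U)%E.

Section boxes.
Context (R : realType) (d : nat).
Implicit Types (u v x : 'rV[R]_d) (b : R).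

Definition dotv u x : R := \sum_(i < d) u ord0 i * x ord0 i.

(* A hyperplane only when u != 0. *)
Definition hyperplane u b : set 'rV[R]_d := [set x | dotv u x = b].

(* Hyperplanes are parallel when they are translates of one another; in
   particular a hyperplane is parallel to itself. *)
Definition parallel (H K : set 'rV[R]_d) : Prop :=
  exists w : 'rV[R]_d, K = [set x + w | x in H].

(* For c strictly increasing, the k-th of the l + 1 consecutive open regions
   cut out by the parallel hyperplanes dotv u x = c i. *)
Definition region l u (c : 'I_l -> R) (k : 'I_l.+1) : set 'rV[R]_d :=
  [set x | forall i : 'I_l,
    if (i < k)%N then c i < dotv u x else dotv u x < c i].

Definition halfspace v b (s : bool) : set 'rV[R]_d :=
  [set x | if s then b < dotv v x else dotv v x < b].

Definition box l u (c : 'I_l -> R) v b (k : 'I_l.+1) (s : bool) :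
    set 'rV[R]_d :=
  region u c k `&` halfspace v b s.

End boxes.

(* Main.v *)
From HB Require Import structures.
Require Import Defs.
From mathcomp Require Import all_boot all_order all_algebra.
From mathcomp Require Import all_classical all_reals all_analysis.
From mathcomp Require Import measurable_realfun.
From mathcomp Require Import zify ring lra.

Set Implicit Arguments.
Unset Strict Implicit.
Unset Printing Implicit Defensive.

Import Order.TTheory GRing.Theory Num.Theory.
Import numFieldNormedType.Exports.

(** For a direction [u], cut the space into [N = 2d - 1] slabs of equal mass
    orthogonal to [u], and for a half-space [w], given by a nonzero vector of
    R^(d+1), compare the masses of the slabs on both sides of [w].  Reversing [u]
    reverses the order of the slabs, so taking sums and differences of the
    discrepancies of opposite slabs gives [2d - 1] functions on S^(d-1) x S^d,
    all odd in [w], of which [d] are even and [d - 1] are odd in [u].  Such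
    functions have a common zero, since the top-degree coefficient of
    [y^d (x + y)^(d-1)] in F_2[x, y]/(x^d, y^(d+1)) is nonzero.  This is made
    elementary as follows: on chains [Z n m] with boundary
    [(1 + h) Z (n-1) m + (1 + g) Z n (m-1)], where [h] and [g] are the two
    antipodal maps, Stokes' formula evaluates the cup product of the coboundaries
    of the signs of the functions to 1, so every iterated barycentric subdivision
    of [Z (d-1) d] has a simplex on which all the functions change sign; the zero
    is a limit of such simplices. *)

(** * Chains modulo 2, subdivision and cup products *)

Section Chains.
Variable V : eqType.
Implicit Types (s t : seq V) (c : seq (seq V)) (phi : seq V -> bool).

Definition chain_eval phi c : bool := \big[addb/false]_(s <- c) phi s.

(** Lists stand for formal sums modulo 2: testing against all cochains forgets the order and cancels
    repeated simplices. *)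
Definition chain_eq c1 c2 := forall phi, chain_eval phi c1 = chain_eval phi c2.

(* Augmented: the only face of a one-point simplex is the empty simplex. *)
Fixpoint faces s : seq (seq V) :=
  if s is v :: s' then s' :: map (cons v) (faces s') else [::].

Definition boundary c := flatten (map faces c).

Definition cone v c : seq (seq V) := map (cons v) c.

Lemma chain_eval_cat phi c1 c2 :
  chain_eval phi (c1 ++ c2) = chain_eval phi c1 (+) chain_eval phi c2.
Proof. exact: big_cat. Qed.

Lemma chain_eval_cons phi s c :
  chain_eval phi (s :: c) = phi s (+) chain_eval phi c.
Proof. exact: big_cons. Qed.

Lemma chain_eval_nil phi : chain_eval phi [::] = false.
Proof. exact: big_nil. Qed.

Lemma chain_eval_map phi (f : seq V -> seq V) c :
  chain_eval phi (map f c) = chain_eval (phi \o f) c.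
Proof. exact: big_map. Qed.

Lemma chain_eval_bind phi (f : seq V -> seq (seq V)) c :
  chain_eval phi (flatten (map f c)) =
  chain_eval (fun s => chain_eval phi (f s)) c.
Proof.
elim: c => [|s c IH] /=; first by rewrite !chain_eval_nil.
by rewrite chain_eval_cat chain_eval_cons IH.
Qed.

Lemma eq_in_chain_eval phi psi c :
  {in c, phi =1 psi} -> chain_eval phi c = chain_eval psi c.
Proof. by move=> e; apply: eq_big_seq. Qed.

Lemma chain_eval_add phi psi c :
  chain_eval (fun s => phi s (+) psi s) c = chain_eval phi c (+) chain_eval psi c.
Proof. exact: big_split. Qed.

Lemma chain_eval_andl b phi c :
  chain_eval (fun s => b && phi s) c = b && chain_eval phi c.
Proof.
by elim: c => [|s c IH]; rewrite ?chain_eval_nil ?andbF// !chain_eval_cons IH andb_addr.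
Qed.

Lemma chain_evalP phi c : chain_eval phi c -> exists2 s, s \in c & phi s.
Proof.
elim: c => [|s c IH]; rewrite ?chain_eval_nil// chain_eval_cons.
case ps: (phi s) => /=; first by exists s => //; rewrite mem_head.
by case/IH => t tc pt; exists t => //; rewrite inE tc orbT.
Qed.

Lemma size_faces s t : t \in faces s -> (size t).+1 = size s.
Proof.
elim: s t => [//|v s IH] t /=; rewrite inE => /predU1P[->//|/mapP[r rs ->]] /=.
by rewrite (IH r).
Qed.

Lemma mem_faces s t v : t \in faces s -> v \in t -> v \in s.
Proof.
elim: s t => [//|w s IH] t /=; rewrite inE => /predU1P[->|/mapP[r rs ->]].
  by move=> ->; rewrite orbT.
by rewrite !inE => /orP[->//|/(IH _ rs) ->]; rewrite orbT.
Qed.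

Lemma faces_map (f : V -> V) s : faces (map f s) = map (map f) (faces s).
Proof.
elim: s => //= v s ->; congr (_ :: _).
by rewrite -!map_comp; apply: eq_map.
Qed.

Lemma chain_eval_boundary phi c :
  chain_eval phi (boundary c) = chain_eval (fun s => chain_eval phi (faces s)) c.
Proof. exact: chain_eval_bind. Qed.

Lemma boundary_cat c1 c2 : boundary (c1 ++ c2) = boundary c1 ++ boundary c2.
Proof. by rewrite /boundary map_cat flatten_cat. Qed.

Lemma boundary_map (f : V -> V) c :
  boundary (map (map f) c) = map (map f) (boundary c).
Proof.
by elim: c => //= s c IH; rewrite /boundary/= map_cat -IH faces_map.
Qed.

Lemma boundary_cone v c :
  chain_eq (boundary (cone v c)) (c ++ cone v (boundary c)).
Proof.
move=> phi; elim: c => [//|s c IH].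
rewrite /boundary/= -/(boundary _) /cone map_cat.
rewrite !(chain_eval_cons, chain_eval_cat) IH !chain_eval_cat -/(boundary _).
by rewrite /cone !addbA; congr (_ (+) _); rewrite -!addbA; congr addb; exact: addbC.
Qed.

Lemma boundaryK s : chain_eq (boundary (faces s)) [::].
Proof.
elim: s => [//|v s IH] phi /=.
rewrite /boundary/= chain_eval_cat -/(boundary _) (boundary_cone v) chain_eval_cat.
rewrite addbA addbb /cone chain_eval_map.
by have := IH (phi \o cons v); rewrite !chain_eval_nil.
Qed.

(** * Barycentric subdivision as a chain map *)

Section Subdivision.
Variable bary : seq V -> V.

(* The first argument bounds the recursion; it is meant to be the size. *)
Fixpoint sd_rec n s : seq (seq V) :=
  if n is n'.+1 then cone (bary s) (flatten (map (sd_rec n') (faces s)))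
  else [:: s].

Definition sd c := flatten (map (fun s => sd_rec (size s) s) c).

(** The cone formula gives the subdivided boundary of [s] plus a cone over its boundary; by
    induction the latter is the subdivision of a double boundary, which vanishes. *)
Lemma boundary_sd_rec n s : size s = n.+1 ->
  chain_eq (boundary (sd_rec n.+1 s)) (flatten (map (sd_rec n) (faces s))).
Proof.
elim: n s => [|n IH] s ss phi; rewrite [sd_rec _ _]/=.
  by case: s ss => [//|v [|//]] _ /=; rewrite !chain_eval_cons !chain_eval_nil.
rewrite boundary_cone chain_eval_cat /cone chain_eval_map.
set psi := _ \o _; rewrite -[RHS]addbF; congr addb.
rewrite chain_eval_boundary chain_eval_bind.
rewrite (@eq_in_chain_eval _ (fun t => chain_eval psi
    (flatten (map (sd_rec n) (faces t))))); last first.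
  move=> t /size_faces; rewrite ss => -[st].
  by rewrite -IH// chain_eval_boundary.
rewrite (@eq_in_chain_eval _ (fun t => chain_eval
    (fun r => chain_eval psi (sd_rec n r)) (faces t))); last first.
  by move=> t _; rewrite chain_eval_bind.
by rewrite -chain_eval_boundary boundaryK chain_eval_nil.
Qed.

Lemma chain_eval_sd phi c :
  chain_eval phi (sd c) = chain_eval (fun s => chain_eval phi (sd_rec (size s) s)) c.
Proof. exact: chain_eval_bind. Qed.

Lemma boundary_sd c : chain_eq (boundary (sd c)) (sd (boundary c)).
Proof.
move=> phi; rewrite chain_eval_boundary !chain_eval_sd chain_eval_boundary.
apply: eq_in_chain_eval => -[|v s] _ /=.
  by rewrite !chain_eval_cons !chain_eval_nil.
rewrite -chain_eval_boundary -/(sd_rec (size s).+1 (v :: s)) boundary_sd_rec//.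
rewrite chain_eval_bind; apply: eq_in_chain_eval => t /(@size_faces (v :: s)).
by move=> [->].
Qed.

Lemma sd_eq c1 c2 : chain_eq c1 c2 -> chain_eq (sd c1) (sd c2).
Proof. by move=> e phi; rewrite !chain_eval_sd. Qed.

Lemma sd_cat c1 c2 : sd (c1 ++ c2) = sd c1 ++ sd c2.
Proof. by rewrite /sd map_cat flatten_cat. Qed.

Lemma sd_map (f : V -> V) c : (forall s, bary (map f s) = f (bary s)) ->
  sd (map (map f) c) = map (map f) (sd c).
Proof.
move=> bf; rewrite /sd map_flatten -!map_comp; congr flatten; apply: eq_map => s /=.
rewrite size_map; move: (size s) => n; elim: n s => [//|n IH] s /=.
have e : map (sd_rec n) (faces (map f s)) = map (map (map f)) (map (sd_rec n) (faces s)).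
  by rewrite faces_map -!map_comp; apply: eq_map => t; exact: IH.
by rewrite bf e -map_flatten /cone -!map_comp.
Qed.

Lemma size_sd_rec n s t : size s = n -> t \in sd_rec n s -> size t = n.
Proof.
elim: n s t => [|n IH] s t ss /=; first by rewrite inE => /eqP ->.
move=> /mapP[r /flatten_mapP[q qs rq] ->] /=; congr S; apply: IH rq.
by move: (size_faces qs); rewrite ss => -[].
Qed.

(** All vertices of the subdivision are barycenters of nonempty faces of [s]. This is used for
    distance bounds and for affine equations. *)
Lemma sd_rec_closed (P : V -> Prop) n s t :
  (forall r, r != [::] -> (forall v, v \in r -> P v) -> P (bary r)) ->
  size s = n -> (forall v, v \in s -> P v) -> t \in sd_rec n s ->
  forall v, v \in t -> P v.
Proof.
move=> Pb; elim: n s t => [|n IH] s t ss Ps /=; first by rewrite inE => /eqP ->.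
move=> /mapP[r /flatten_mapP[q qs rq] ->] v; rewrite inE => /predU1P[->|].
  by apply: Pb => //; case: s ss {Ps qs}.
apply: IH rq v; first by move: (size_faces qs); rewrite ss => -[].
by move=> v vq; apply: Ps; exact: mem_faces vq.
Qed.

End Subdivision.

(** * Cup products of coboundaries *)

Section Cup.
Implicit Types (f : V -> bool) (fs : seq (V -> bool)).

(* [cup fs s] is the value on the ordered simplex [s] of the cup product of the
   coboundaries of the 0-cochains in [fs]. *)
Fixpoint cup_from v fs s : bool :=
  match fs, s with
  | [::], _ => true
  | f :: fs', w :: s' => (f v (+) f w) && cup_from w fs' s'
  | _, [::] => false
  end.

Definition cup fs s := if s is v :: s' then cup_from v fs s' else false.

(** A product of cocycles is a cocycle. The faces omitting [v] or [w] add up to the coefficient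
    [f v (+) f w], as [f x] cancels; all other faces carry the same coefficient, and the cofactor
    vanishes by induction on the simplex without [v]. *)
Lemma cup_cocycle fs s : size s = (size fs).+2 -> chain_eval (cup fs) (faces s) = false.
Proof.
elim: fs s => [|f fs IH] [|v [|w s]]// [ss].
  by case: s ss => // _; rewrite /= !chain_eval_cons !chain_eval_nil.
case: s ss => [//|x s] /= [ss].
rewrite !chain_eval_cons /= -!map_comp chain_eval_map.
rewrite (@eq_in_chain_eval _ (fun t => (f v (+) f w) && cup fs (w :: x :: t))) //.
rewrite chain_eval_andl.
have := IH [:: w, x & s]; rewrite /= ss => /(_ erefl).
rewrite !chain_eval_cons /= -map_comp chain_eval_map /comp/=.
rewrite -/(chain_eval _ _) addbA => /eqP.
move: (cup_from x _ _) (cup_from w _ _) (chain_eval _ _) (f v) (f w) (f x).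
by do 6 case.
Qed.

(** Leibniz rule: since [cup fs] is a cocycle, only the coboundary of [f] contributes. Combined with
    Stokes' formula, it removes one function at a time. *)
Lemma cup_coboundary f fs s : size s = (size fs).+2 ->
  chain_eval (fun t => if t is v :: _ then f v && cup fs t else false) (faces s) =
  cup (f :: fs) s.
Proof.
case: s => [//|v [//|w s]] [ss] /=.
have := @cup_cocycle fs [:: v, w & s]; rewrite /= ss => /(_ erefl).
rewrite !chain_eval_cons -map_comp !chain_eval_map /= => e.
rewrite (@eq_in_chain_eval _ (fun t => f v && cup fs (v :: w :: t))) //.
rewrite chain_eval_andl; move: e; rewrite /comp/=; move: (chain_eval _ _) => a.
move: (cup_from w _ _) (cup_from v _ _) (f v) (f w) a.
by do 5 case.
Qed.

(** A nonzero product has all its factors nonzero, and the [i]-th factor compares the two ends of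
    the [i]-th edge. *)
Lemma cup_from_change v fs s f0 i : cup_from v fs s -> (i < size fs)%N ->
  exists x y, [/\ x \in v :: s, y \in v :: s & nth f0 fs i x != nth f0 fs i y].
Proof.
elim: fs v s i => [//|f fs IH] v [//|w s] [|i] /= /andP[fvw cs] ifs.
  exists v, w; rewrite !inE !eqxx orbT; split => //.
  by apply: contraTN fvw => /eqP ->; rewrite addbb.
have [x [y [xs ys xy]]] := IH _ _ _ cs ifs.
by exists x, y; rewrite inE xs inE ys !orbT.
Qed.

Lemma cup_change fs s f0 i : cup fs s -> (i < size fs)%N ->
  exists x y, [/\ x \in s, y \in s & nth f0 fs i x != nth f0 fs i y].
Proof. by case: s => //= v s; exact: cup_from_change. Qed.

(** Here [b] is the parity, [true] meaning odd. It is required on [D] only, because signs can be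
    chosen equivariantly only where the vectors are nonzero. *)
Definition twisted (D : pred V) (h : V -> V) (b : bool) (f : V -> bool) :=
  forall v, D v -> f (h v) = f v (+) b.

Lemma cup_from_twisted (D : pred V) (h : V -> V) fs v s :
  (forall i, (i < size fs)%N -> exists b, twisted D h b (nth xpredT fs i)) ->
  D v -> all D s -> cup_from (h v) fs (map h s) = cup_from v fs s.
Proof.
elim: fs v s => [//|f fs IH] v [//|w s] fsP Dv /= /andP[Dw Ds].
have [b fb] := fsP 0%N isT; rewrite /= in fb; rewrite !fb//.
rewrite IH//; last by move=> i ifs; apply: fsP i.+1 ifs.
by rewrite addbACA addbb addbF.
Qed.

End Cup.

(** * Stokes' formula on products of hemispheres *)

Section Equivariant.
Variables (h g : V -> V) (D : pred V).
Implicit Types (Z : nat -> nat -> seq (seq V)) (f : V -> bool) (fs : seq (V -> bool)).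

Definition orbit_sum (k : V -> V) c := c ++ map (map k) c.

(* The boundary of (upper hemisphere of S^n) x (upper hemisphere of S^m), where
   h and g are the antipodal maps of the two factors. *)
Definition product_boundary Z n m : seq (seq V) :=
  match n, m with
  | 0, 0 => [:: [::]]
  | n'.+1, 0 => orbit_sum h (Z n' 0)
  | 0, m'.+1 => orbit_sum g (Z 0 m')
  | n'.+1, m'.+1 => orbit_sum h (Z n' m) ++ orbit_sum g (Z n m')
  end.

Definition hemisphere_chains Z := forall n m,
  chain_eq (boundary (Z n m)) (product_boundary Z n m).

(** Coboundaries of twisted functions are [k]-invariant, so a simplex and its image share the factor
    [cup fs s], while the values of [f] differ by [b]: an even [f] kills the sum, an odd one reduces
    it to [c]. *)
Lemma cup_orbit_sum k b f fs c : all (all D) c -> twisted D k b f ->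
  (forall i, (i < size fs)%N -> exists b', twisted D k b' (nth xpredT fs i)) ->
  (forall s, s \in c -> s != [::]) ->
  chain_eval (fun t => if t is v :: _ then f v && cup fs t else false) (orbit_sum k c) =
  b && chain_eval (cup fs) c.
Proof.
move=> /allP cD fb fsP c0; rewrite chain_eval_cat chain_eval_map -chain_eval_add.
rewrite -chain_eval_andl; apply: eq_in_chain_eval => -[|v s] sc /=.
  by have := c0 _ sc.
have := cD _ sc; rewrite /= => /andP[Dv Ds].
rewrite (cup_from_twisted fsP)// fb//.
by move: (f v) (cup_from _ _ _) => [] []; case: (b).
Qed.

(** Each function of [fsE] kills the [h] part of the boundary and lowers the second dimension by
    one; when that reaches 0, each function of [fsO] lowers the first, down to [Z 0 0]. *)
Lemma cup_hemisphere Z fsE fsO :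
  hemisphere_chains Z ->
  (forall n m s, s \in Z n m -> size s = (n + m).+1) ->
  (forall n m, (n <= size fsO)%N -> (m <= size fsE)%N -> all (all D) (Z n m)) ->
  (forall i, (i < size fsE)%N -> twisted D h false (nth xpredT fsE i) /\
                                twisted D g true (nth xpredT fsE i)) ->
  (forall i, (i < size fsO)%N -> twisted D h true (nth xpredT fsO i) /\
                                twisted D g true (nth xpredT fsO i)) ->
  chain_eval (cup (fsE ++ fsO)) (Z (size fsO) (size fsE)).
Proof.
move=> bZ sZ DZ fsEP fsOP.
have Z0 n m s : s \in Z n m -> s != [::] by move/sZ; case: s.
have step f fs n m : (n + m = (size fs).+1)%N ->
    chain_eval (cup (f :: fs)) (Z n m) =
    chain_eval (fun t => if t is v :: _ then f v && cup fs t else false)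
      (product_boundary Z n m).
  move=> nm; rewrite -bZ chain_eval_boundary; apply: eq_in_chain_eval => s sZnm.
  by rewrite cup_coboundary//= (sZ _ _ _ sZnm) nm.
elim: fsE DZ fsEP => [|f fs IH] DZ fsEP /=.
  elim: fsO DZ fsOP {fsEP} => [_ _|f fs IH DZ fsOP] /=.
    (* The boundary being augmented, the parity of the number of points of [Z 0 0] is read off its
       boundary, the single empty simplex. *)
    have b0 : chain_eval (fun=> true) (boundary (Z 0 0)) = true.
      by rewrite bZ chain_eval_cons chain_eval_nil.
    apply: etrans b0; rewrite chain_eval_boundary.
    apply: eq_in_chain_eval => -[|v [|w s]] /sZ //= _.
    by rewrite chain_eval_cons chain_eval_nil.
  rewrite step ?addn0//= (@cup_orbit_sum _ true).
  - apply: IH => [n m ns|i ifs]; last exact: fsOP i.+1 ifs.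
    by apply: DZ; rewrite (leq_trans ns)/=.
  - by apply: DZ => /=.
  - by have [] := fsOP 0%N isT.
  - by move=> i ifs; exists true; have [] := fsOP i.+1 ifs.
  - by move=> s; exact: Z0.
have fsP k : k = h \/ k = g -> forall i, (i < size (fs ++ fsO))%N ->
    exists b', twisted D k b' (nth xpredT (fs ++ fsO) i).
  move=> kP i; rewrite size_cat nth_cat => ifsO; case: (ltnP i (size fs)) => [ifs|ifs].
    by have [? ?] := fsEP i.+1 ifs; case: kP => ->; [exists false|exists true].
  have ifs' : (i - size fs < size fsO)%N by rewrite ltn_subLR.
  by have [? ?] := fsOP _ ifs'; case: kP => ->; exists true.
have [fh fg] := fsEP 0%N isT; rewrite /= in fh fg.
have {}IH := IH (fun n m ns ms => DZ n m ns (leqW ms)) (fun i ifs => fsEP i.+1 ifs).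
rewrite step; last by rewrite size_cat addnS addnC.
rewrite /product_boundary; case: (size fsO) IH DZ => [|n] IH DZ; last first.
  rewrite chain_eval_cat (@cup_orbit_sum _ false)//=; last exact: Z0.
  - rewrite (@cup_orbit_sum _ true)//=; last exact: Z0.
      by apply: DZ => /=.
    exact: fsP (or_intror erefl).
  - by apply: DZ => /=.
  - exact: fsP (or_introl erefl).
rewrite (@cup_orbit_sum _ true)//=; last exact: Z0.
  by apply: DZ => /=.
exact: fsP (or_intror erefl).
Qed.

End Equivariant.

(** * Hemisphere chains by iterated coning *)

Section Construction.
Variables (h g : V -> V) (e : nat -> nat -> V).
Hypotheses (hK : involutive h) (gK : involutive g) (hg : forall v, h (g v) = g (h v)).

(** The chain fills the cycle [product_boundary] by a cone of apex [e n m]; the nested [fix] allows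
    recursion on either index. *)
Fixpoint hemi_chain n : nat -> seq (seq V) :=
  fix hemi_chain_n m : seq (seq V) :=
  cone (e n m)
    match n, m with
    | 0, 0 => [:: [::]]
    | n'.+1, 0 => orbit_sum h (hemi_chain n' 0)
    | 0, m'.+1 => orbit_sum g (hemi_chain_n m')
    | n'.+1, m'.+1 => orbit_sum h (hemi_chain n' m) ++ orbit_sum g (hemi_chain_n m')
    end.

Arguments hemi_chain : simpl never.

Lemma hemi_chainE n m : hemi_chain n m = cone (e n m) (product_boundary h g hemi_chain n m).
Proof. by case: n m => [|n] [|m]. Qed.

Lemma orbit_sum_cat (k : V -> V) c1 c2 :
  chain_eq (orbit_sum k (c1 ++ c2)) (orbit_sum k c1 ++ orbit_sum k c2).
Proof.
by move=> phi; rewrite /orbit_sum map_cat !chain_eval_cat addbACA.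
Qed.

Lemma orbit_sum_eq (k : V -> V) c1 c2 :
  chain_eq c1 c2 -> chain_eq (orbit_sum k c1) (orbit_sum k c2).
Proof. by move=> e12 phi; rewrite /orbit_sum !chain_eval_cat !chain_eval_map !e12. Qed.

Lemma orbit_sumK (k : V -> V) c : involutive k -> chain_eq (orbit_sum k (orbit_sum k c)) [::].
Proof.
move=> kK phi; rewrite /orbit_sum map_cat (mapK (mapK kK)).
rewrite !chain_eval_cat chain_eval_nil.
by case: (chain_eval _ _) (chain_eval _ _) => -[].
Qed.

Lemma orbit_sumC c : chain_eq (orbit_sum h (orbit_sum g c)) (orbit_sum g (orbit_sum h c)).
Proof.
move=> phi; rewrite /orbit_sum !map_cat !chain_eval_cat -!map_comp.
rewrite (@eq_map _ _ (map h \o map g) (map g \o map h)); first by rewrite addbACA.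
by move=> s /=; rewrite -!map_comp; exact: eq_map.
Qed.

Lemma boundary_orbit_sum (k : V -> V) c : boundary (orbit_sum k c) = orbit_sum k (boundary c).
Proof. by rewrite /orbit_sum boundary_cat boundary_map. Qed.

(** A cone over a cycle has that cycle as boundary, so it suffices that each [product_boundary] is a
    cycle: modulo 2 the squares of 1 + h and 1 + g vanish, and the mixed terms cancel because [h]
    and [g] commute. *)
Lemma hemisphere_hemi_chain : hemisphere_chains h g hemi_chain.
Proof.
suff bb n m : chain_eq (boundary (product_boundary h g hemi_chain n m)) [::].
  move=> n m phi; rewrite hemi_chainE boundary_cone chain_eval_cat /cone chain_eval_map.
  by rewrite bb chain_eval_nil addbF.
have [k] := ubnP (n + m); elim: k n m => // k IH n m; rewrite ltnS => nmk.
have IHb n' m' : (n' + m' < k)%N ->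
    chain_eq (boundary (hemi_chain n' m')) (product_boundary h g hemi_chain n' m').
  move=> n'm' phi; rewrite hemi_chainE boundary_cone chain_eval_cat /cone chain_eval_map.
  by rewrite IH// chain_eval_nil addbF.
have tr c1 c2 c3 : chain_eq c1 c2 -> chain_eq c2 c3 -> chain_eq c1 c3.
  by move=> a b phi; rewrite a b.
move: n m nmk => [|n] [|m]; rewrite ?addn0 ?add0n => nmk phi.
- by [].
- rewrite /= boundary_orbit_sum (orbit_sum_eq g (IHb 0%N m nmk)).
  case: m {nmk} => [|m] /=; last by rewrite orbit_sumK.
  by rewrite !chain_eval_cons chain_eval_nil addbF addbb.
- rewrite /= boundary_orbit_sum (orbit_sum_eq h (IHb n 0%N _)) ?addn0//.
  case: n {nmk} => [|n] /=; last by rewrite orbit_sumK.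
  by rewrite !chain_eval_cons chain_eval_nil addbF addbb.
rewrite [product_boundary _ _ _ _ _]/= boundary_cat !boundary_orbit_sum chain_eval_cat.
rewrite (orbit_sum_eq h (IHb n m.+1 _)); last by rewrite -addSn.
rewrite (orbit_sum_eq g (IHb n.+1 m _)); last by rewrite -addnS.
rewrite chain_eval_nil.
case: n m {nmk} => [|n] [|m] /=.
- by rewrite orbit_sumC addbb.
- rewrite orbit_sum_cat chain_eval_cat orbit_sumK// chain_eval_nil addbF.
  by rewrite orbit_sumC addbb.
- rewrite orbit_sum_cat chain_eval_cat orbit_sumK// chain_eval_nil /=.
  by rewrite orbit_sumC addbb.
rewrite (orbit_sum_cat g) [X in _ (+) X]chain_eval_cat (orbit_sumK _ gK) chain_eval_nil addbF.
by rewrite (orbit_sum_cat h) chain_eval_cat (orbit_sumK _ hK) orbit_sumC chain_eval_nil addbb.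
Qed.

Lemma size_hemi_chain n m s : s \in hemi_chain n m -> size s = (n + m).+1.
Proof.
have sumP k c N : (forall s, s \in c -> size s = N) ->
    forall s, s \in orbit_sum k c -> size s = N.
  move=> cP t; rewrite mem_cat => /orP[/cP//|/mapP[r /cP rN ->]].
  by rewrite size_map.
have [k] := ubnP (n + m); elim: k n m s => // k IH n m s; rewrite ltnS => nmk.
rewrite hemi_chainE => /mapP[r rP ->]; congr S.
move: n m nmk rP => [|n] [|m]; rewrite ?addn0 ?add0n => nmk rP.
- by move: rP; rewrite inE => /eqP ->.
- by apply: sumP rP => t /IH; apply.
- by apply: sumP rP => t /IH; rewrite addn0; apply.
move: rP; rewrite /= mem_cat => /orP[] rP.
  by apply: sumP rP => t /IH; rewrite addSn; apply; rewrite -addSn.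
by apply: sumP rP => t /IH; rewrite addnS; apply; rewrite -addnS.
Qed.

Lemma sd_hemisphere_chains (bary : seq V -> V) (Z : nat -> nat -> seq (seq V)) :
  (forall s, bary (map h s) = h (bary s)) ->
  (forall s, bary (map g s) = g (bary s)) ->
  hemisphere_chains h g Z ->
  hemisphere_chains h g (fun n m => sd bary (Z n m)).
Proof.
move=> bh bg bZ n m phi; rewrite boundary_sd (sd_eq _ (bZ n m)).
by case: n m => [|n] [|m] //=; rewrite ?sd_cat !sd_map.
Qed.

End Construction.
End Chains.

Local Open Scope classical_set_scope.
Local Open Scope ring_scope.

(** * Common zeros of equivariant functions on a product of two spheres *)

Section Barycenter.
Variables (R : realType) (V : normedModType R).
Implicit Types (s t : seq V) (x y : V).

Definition barycenter s : V := (size s)%:R^-1 *: \sum_(x <- s) x.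

Lemma barycenter_linear (k : V -> V) s : linear k ->
  barycenter (map k s) = k (barycenter s).
Proof.
move=> kl; pose kL : {linear V -> V} := HB.pack k (GRing.isLinear.Build _ _ _ _ k kl).
rewrite -[k]/(kL : V -> V); move: kL => {kl}k.
rewrite /barycenter size_map big_map linearZ; congr (_ *: _).
by rewrite linear_sum.
Qed.

Lemma barycenter_subl s y : s != [::] ->
  barycenter s - y = (size s)%:R^-1 *: \sum_(x <- s) (x - y).
Proof.
move=> s0; rewrite sumrB scalerBr; congr (_ - _).
rewrite big_const_seq count_predT iter_addr_0 -[y *+ _]scaler_nat scalerA mulVf ?scale1r//.
by rewrite pnatr_eq0 size_eq0.
Qed.

Lemma barycenter_ball s y (r : R) : s != [::] ->
  (forall x, x \in s -> `|x - y| <= r) -> `|barycenter s - y| <= r.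
Proof.
move=> s0 sr; rewrite barycenter_subl// normrZ ger0_norm ?invr_ge0//.
rewrite ler_pdivrMl ?ltr0n ?lt0n ?size_eq0//.
rewrite (le_trans (ler_norm_sum _ _ _))//.
rewrite mulr_natl -[in leRHS]count_predT -iter_addr_0 -big_const_seq.
by rewrite big_seq [leRHS]big_seq; apply: ler_sum.
Qed.

Lemma barycenter_dist s y (D : R) : y \in s ->
  (forall x, x \in s -> `|x - y| <= D) ->
  `|barycenter s - y| <= (size s).-1%:R / (size s)%:R * D.
Proof.
move=> ys sD; have s0 : s != [::] by case: s ys {sD}.
rewrite barycenter_subl// normrZ ger0_norm ?invr_ge0// mulrAC mulrC.
apply: ler_wpM2r; first by rewrite invr_ge0.
rewrite (big_rem y)//= subrr add0r (le_trans (ler_norm_sum _ _ _))//.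
rewrite mulr_natl -(size_rem ys) -[in leRHS]count_predT -iter_addr_0 -big_const_seq.
by rewrite big_seq [leRHS]big_seq; apply: ler_sum => x /mem_rem; exact: sD.
Qed.

Definition mesh_le s (D : R) := forall x y, x \in s -> y \in s -> `|x - y| <= D.

(** The barycenter of n + 1 points is within n/(n+1) [D] of each of them, hence, balls being convex,
    of all vertices of the subdivided faces; the other pairs are covered by induction. The ratio
    increases with n, so [N] gives a uniform factor. *)
Lemma mesh_sd_rec N n s t (D : R) : 0 <= D -> size s = n -> (n <= N.+1)%N ->
  mesh_le s D -> t \in sd_rec barycenter n s -> mesh_le t (N%:R / N.+1%:R * D).
Proof.
move=> D0; elim: n s t => [|n IH] s t ss nN sD /=.
  by case: s ss sD => // _ _; rewrite inE => /eqP ->.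
have cD : n%:R / n.+1%:R * D <= N%:R / N.+1%:R * D.
  apply: ler_wpM2r => //; rewrite ler_pdivrMr ?ltr0n// mulrAC ler_pdivlMr ?ltr0n//.
  by rewrite -!natrM ler_nat; nia.
move=> /mapP[r /flatten_mapP[q qs rq] ->].
have qn : size q = n by move: (size_faces qs); rewrite ss => -[].
have rD : mesh_le r (N%:R / N.+1%:R * D).
  apply: IH rq => //; first exact: ltnW.
  by move=> x y xq yq; apply: sD; exact: mem_faces qs _.
have br y : y \in r -> `|y - barycenter s| <= N%:R / N.+1%:R * D.
  apply: (sd_rec_closed (P := fun y => `|y - barycenter s| <= N%:R / N.+1%:R * D)
    _ qn _ rq).
    by move=> p p0 pP; exact: barycenter_ball.
  move=> {}y /(mem_faces qs) ys; rewrite distrC (le_trans _ cD)//.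
  have -> : n = (size s).-1 by rewrite ss.
  have -> : (size s).-1.+1 = size s by rewrite ss.
  by apply: barycenter_dist => // x xs; exact: sD.
have nn : 0 <= N%:R / N.+1%:R * D by rewrite mulr_ge0// divr_ge0.
move=> x y; rewrite !inE => /predU1P[->|xr] /predU1P[->|yr].
- by rewrite subrr normr0.
- by rewrite distrC; exact: br.
- exact: br.
- exact: rD.
Qed.

End Barycenter.

(** * Inner products and faces of the cross-polytope *)

Section Coarse.
Variables (R : realType).

Lemma dotvDr d (a x y : 'rV[R]_d) : dotv a (x + y) = dotv a x + dotv a y.
Proof. by rewrite /dotv -big_split; apply: eq_bigr => i _; rewrite mxE mulrDr. Qed.

Lemma dotvZr d (a x : 'rV[R]_d) c : dotv a (c *: x) = c * dotv a x.
Proof. by rewrite /dotv mulr_sumr; apply: eq_bigr => i _; rewrite mxE mulrCA. Qed.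

Lemma dotvNr d (a x : 'rV[R]_d) : dotv a (- x) = - dotv a x.
Proof. by rewrite -scaleN1r dotvZr mulN1r. Qed.

Lemma dotvC d (a x : 'rV[R]_d) : dotv a x = dotv x a.
Proof. by apply: eq_bigr => i _; rewrite mulrC. Qed.

Lemma dotvDl d (a b x : 'rV[R]_d) : dotv (a + b) x = dotv a x + dotv b x.
Proof. by rewrite dotvC dotvDr !(dotvC x). Qed.

Lemma dotvZl d (a x : 'rV[R]_d) c : dotv (c *: a) x = c * dotv a x.
Proof. by rewrite dotvC dotvZr (dotvC x). Qed.

Lemma dotvNl d (a x : 'rV[R]_d) : dotv (- a) x = - dotv a x.
Proof. by rewrite dotvC dotvNr (dotvC x). Qed.

Lemma dotv_sumr d (a : 'rV[R]_d) (s : seq 'rV[R]_d) :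
  dotv a (\sum_(x <- s) x) = \sum_(x <- s) dotv a x.
Proof.
elim: s => [|x s IH]; last by rewrite !big_cons dotvDr IH.
by rewrite !big_nil -(scale0r 0) dotvZr mul0r.
Qed.

Lemma mx_norm_coord d (x : 'rV[R]_d) i : `|x ord0 i| <= `|x|.
Proof.
rewrite [leRHS](mx_normrE x); apply/bigmax_geP; right => /=.
by exists (ord0, i).
Qed.

Lemma mx_norm_le d (x : 'rV[R]_d) (c : R) : 0 <= c ->
  (forall i, `|x ord0 i| <= c) -> `|x| <= c.
Proof.
move=> c0 xc; rewrite [leLHS](mx_normrE x); apply/bigmax_leP; split => //.
by move=> [i j] _ /=; rewrite (ord1 i).
Qed.

(** The norm is the maximum norm, so each of the [d] terms is at most [|x|]. This keeps the points
    of the chains away from 0. *)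
Lemma dotv_norm_ge d (a x : 'rV[R]_d) : (forall i, `|a ord0 i| <= 1) ->
  dotv a x = 1 -> 1 <= d%:R * `|x|.
Proof.
move=> a1 ax; rewrite -[leLHS]normr1 -[in leLHS]ax (le_trans (ler_norm_sum _ _ _))//.
have -> : d%:R * `|x| = \sum_(i < d) `|x| by rewrite sumr_const card_ord mulr_natl.
apply: ler_sum => i _.
rewrite normrM (le_trans _ (mx_norm_coord x i))// -[leRHS]mul1r.
by rewrite ler_wpM2r.
Qed.

Definition unit_row d (k : nat) : 'rV[R]_d := \row_i ((i : nat) == k)%:R.

(* The vertices of [s] are, up to signs, unit vectors of index at most [k], and
   they never include both a vector and its opposite. *)
Definition cross_face d (k : nat) (s : seq 'rV[R]_d) := exists a : 'rV[R]_d,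
  [/\ forall i, `|a ord0 i| <= 1, forall i : 'I_d, i = k :> nat -> a ord0 i = 1 &
      forall v, v \in s -> [/\ dotv a v = 1, `|v| <= 1 &
        forall i : 'I_d, (k < i)%N -> v ord0 i = 0]].

Lemma cross_face_cons d k s : (k < d)%N ->
  @cross_face d k s -> @cross_face d k (unit_row d k :: s).
Proof.
move=> kd [a [a1 ak sP]]; exists a; split => // v; rewrite inE => /predU1P[->|/sP//].
split.
- rewrite /dotv (bigD1 (Ordinal kd))//= mxE eqxx mulr1 ak// big1 ?addr0// => i ik.
  rewrite mxE; case: eqP => [e|]; last by rewrite mulr0.
  by move: ik; rewrite -val_eqE /= e eqxx.
- by apply: mx_norm_le => // i; rewrite mxE; case: eqP; rewrite ?normr1 ?normr0.
- by move=> i ki; rewrite mxE gtn_eqF.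
Qed.

(** Coordinate [k.+1] vanishes on [s], so that coefficient of [a] is free; setting it to 1 makes
    room for the next apex [unit_row]. *)
Lemma cross_face_step d k s : @cross_face d k s -> @cross_face d k.+1 s.
Proof.
move=> [a [a1 ak sP]].
exists (\row_i if i == k.+1 :> nat then 1 else a ord0 i); split.
- by move=> i; rewrite mxE; case: ifP; rewrite ?normr1.
- by move=> i ik; rewrite mxE ik eqxx.
move=> v /sP[av v1 vk]; split => // [|i ki]; last by rewrite vk// (ltn_trans _ ki).
rewrite -av; apply: eq_bigr => i _; rewrite mxE; case: eqP => // ik.
by rewrite vk ?mulr0// ik.
Qed.

Lemma cross_face_opp d k s : @cross_face d k s -> @cross_face d k.+1 (map -%R s).
Proof.
move=> [a [a1 ak sP]].
exists (\row_i if i == k.+1 :> nat then 1 else - a ord0 i); split.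
- by move=> i; rewrite mxE; case: ifP; rewrite ?normr1// normrN.
- by move=> i ik; rewrite mxE ik eqxx.
move=> _ /mapP[v /sP[av v1 vk] ->]; split => [||i ki].
- rewrite -av; apply: eq_bigr => i _; rewrite !mxE; case: eqP => [ik|].
    by rewrite vk ?ik// oppr0 !mulr0.
  by rewrite mulrNN.
- by rewrite normrN.
by rewrite mxE vk ?oppr0// (ltn_trans _ ki).
Qed.

Lemma cross_face_nil d : @cross_face d 0 [::].
Proof.
exists (unit_row d 0); split => // i; rewrite mxE; last by move=> ->.
by case: eqP; rewrite ?normr1 ?normr0.
Qed.

End Coarse.

(** * Fine chains in a product of two spheres *)

Section EquivariantZero.
Variables (R : realType) (p q : nat).
Let V : normedModType R := ('rV[R]_p * 'rV[R]_q)%type.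
Implicit Types (v x y z : V) (s t : seq V).

Definition antipode1 v : V := (- v.1, v.2).
Definition antipode2 v : V := (v.1, - v.2).

Lemma antipode1K : involutive antipode1.
Proof. by case=> u w; rewrite /antipode1/= opprK. Qed.

Lemma antipode2K : involutive antipode2.
Proof. by case=> u w; rewrite /antipode2/= opprK. Qed.

Lemma antipode1_linear : linear antipode1.
Proof.
move=> c x y; rewrite /antipode1/=; apply/eqP; rewrite xpair_eqE; apply/andP; split=> //=.
by rewrite opprD scalerN.
Qed.

Lemma antipode2_linear : linear antipode2.
Proof.
move=> c x y; rewrite /antipode2/=; apply/eqP; rewrite xpair_eqE; apply/andP; split=> //=.
by rewrite opprD scalerN.
Qed.

Definition sphere_chain := hemi_chain antipode1 antipode2
  (fun n m => (unit_row R p n, unit_row R q m) : V).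

(** Induction along the construction: an antipode keeps or negates a component, and coning adds a
    unit vector to both. Thus neither component of a simplex surrounds the origin. *)
Lemma sphere_chain_cross_face n m s : (n < p)%N -> (m < q)%N -> s \in sphere_chain n m ->
  cross_face n (map fst s) /\ cross_face m (map snd s).
Proof.
have sum1 c (P : seq 'rV[R]_p -> Prop) (Q : seq 'rV[R]_q -> Prop) :
    (forall t, t \in c -> [/\ P (map fst t), P (map -%R (map fst t)) & Q (map snd t)]) ->
    forall t, t \in orbit_sum antipode1 c -> P (map fst t) /\ Q (map snd t).
  move=> cP t; rewrite mem_cat => /orP[/cP[]//|/mapP[r /cP[_ Pr Qr] ->]].
  by rewrite -!map_comp; move: Pr Qr; rewrite -map_comp.
have sum2 c (P : seq 'rV[R]_p -> Prop) (Q : seq 'rV[R]_q -> Prop) :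
    (forall t, t \in c -> [/\ P (map fst t), Q (map snd t) & Q (map -%R (map snd t))]) ->
    forall t, t \in orbit_sum antipode2 c -> P (map fst t) /\ Q (map snd t).
  move=> cP t; rewrite mem_cat => /orP[/cP[]//|/mapP[r /cP[Pr _ Qr] ->]].
  by rewrite -!map_comp; move: Pr Qr; rewrite -map_comp.
have [k] := ubnP (n + m); elim: k n m s => // k IH n m s; rewrite ltnS => nmk np mq.
rewrite /sphere_chain hemi_chainE -/sphere_chain => /mapP[r rP ->] /=.
suff [f1 f2] : cross_face n (map fst r) /\ cross_face m (map snd r).
  by split; apply: cross_face_cons.
move: n m nmk np mq rP => [|n] [|m]; rewrite ?addn0 ?add0n => nmk np mq rP.
- by move: rP; rewrite inE => /eqP ->; split; exact: cross_face_nil.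
- apply: (sum2 _ (cross_face 0) (cross_face m.+1)) rP => t /IH.
  rewrite add0n => /(_ nmk np (ltnW mq))[f1 f2].
  by split; [|exact: cross_face_step|exact: cross_face_opp].
- apply: (sum1 _ (cross_face n.+1) (cross_face 0)) rP => t /IH.
  rewrite addn0 => /(_ nmk (ltnW np) mq)[f1 f2].
  by split; [exact: cross_face_step|exact: cross_face_opp|].
move: rP; rewrite /product_boundary mem_cat => /orP[] rP.
  apply: (sum1 _ (cross_face n.+1) (cross_face m.+1)) rP => t /IH.
  rewrite -addSn => /(_ nmk (ltnW np) mq)[f1 f2].
  by split; [exact: cross_face_step|exact: cross_face_opp|].
apply: (sum2 _ (cross_face n.+1) (cross_face m.+1)) rP => t /IH.
rewrite -addnS => /(_ nmk np (ltnW mq))[f1 f2].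
by split; [|exact: cross_face_step|exact: cross_face_opp].
Qed.

(** The part of [cross_face] needed after subdivision: affine equations and a norm bound, all stable
    under barycenters. *)
Definition cross_simplex s := exists (a : 'rV[R]_p) (b : 'rV[R]_q),
  [/\ forall i, `|a ord0 i| <= 1, forall i, `|b ord0 i| <= 1 &
      forall v, v \in s -> [/\ dotv a v.1 = 1, dotv b v.2 = 1 & `|v| <= 1]].

Definition fine_chain r n m := iter r (sd (@barycenter R V)) (sphere_chain n m).

Lemma cross_simplex_fine r n m s : (n < p)%N -> (m < q)%N ->
  s \in fine_chain r n m -> cross_simplex s.
Proof.
move=> np mq; elim: r s => [|r IH] s /=.
  move=> /(sphere_chain_cross_face np mq)[[a [a1 _ aP]] [b [b1 _ bP]]].
  exists a, b; split => // v vs.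
  have [av v1 _] := aP _ (map_f fst vs); have [bv v2 _] := bP _ (map_f snd vs).
  by split => //; rewrite prod_normE ge_max v1.
move=> /flatten_mapP[t /IH[a [b [a1 b1 abP]]] st]; exists a, b; split => //.
apply: (sd_rec_closed _ erefl abP st) => z z0 zP.
have avg d (c : 'rV[R]_d) (f : V -> 'rV[R]_d) :
    f (barycenter z) = (size z)%:R^-1 *: \sum_(x <- map f z) x ->
    (forall x, x \in z -> dotv c (f x) = 1) -> dotv c (f (barycenter z)) = 1.
  move=> -> cz; rewrite dotvZr dotv_sumr big_map (eq_big_seq _ cz).
  rewrite big_const_seq count_predT iter_addr_0 mulVf//.
  by rewrite pnatr_eq0 size_eq0.
split.
- apply: avg => [|x /zP[]//].
  rewrite /barycenter/= big_map; congr (_ *: _).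
  by elim/big_ind2: _ => // ? ? ? ? <- <-.
- apply: avg => [|x /zP[]//].
  rewrite /barycenter/= big_map; congr (_ *: _).
  by elim/big_ind2: _ => // ? ? ? ? <- <-.
- rewrite -[barycenter z]subr0; apply: barycenter_ball => // x /zP[_ _].
  by rewrite subr0.
Qed.

Lemma size_fine r n m s : s \in fine_chain r n m -> size s = (n + m).+1.
Proof.
elim: r s => [|r IH] s /=; first exact: size_hemi_chain.
by move=> /flatten_mapP[t /IH <-]; exact: size_sd_rec.
Qed.

Lemma mesh_fine r n m s : (n < p)%N -> (m < q)%N -> s \in fine_chain r n m ->
  mesh_le s (((n + m)%:R / (n + m).+1%:R) ^+ r * 2).
Proof.
move=> np mq; elim: r s => [|r IH] s.
  rewrite expr0 mul1r => /(@cross_simplex_fine 0)-/(_ np mq)[a [b [_ _ abP]]] x y xs ys.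
  rewrite (le_trans (ler_normB _ _))// (_ : 2 = 1 + 1 :> R)//.
  by have [_ _ ?] := abP _ xs; have [_ _ ?] := abP _ ys; exact: lerD.
move=> /flatten_mapP[t tr]; rewrite exprS -mulrA.
apply: mesh_sd_rec => //; last exact: IH.
by rewrite (size_fine tr).
Qed.

Lemma fine_chains r : hemisphere_chains antipode1 antipode2 (fine_chain r).
Proof.
elim: r => [|r IH].
  by apply: hemisphere_hemi_chain; [exact: antipode1K|exact: antipode2K|].
apply: sd_hemisphere_chains => // s; apply: barycenter_linear.
  exact: antipode1_linear.
exact: antipode2_linear.
Qed.

End EquivariantZero.

(** * From sign changes on small simplices to a common zero *)

Section SignChange.
Variables (R : realType) (n m : nat).
Let V : normedModType R := ('rV[R]_n.+1 * 'rV[R]_m.+1)%type.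
Implicit Types (v x y : V) (s : seq V).

Definition first_coord_pos d (x : 'rV[R]_d) :=
  if [pick j | x ord0 j != 0] is Some j then 0 < x ord0 j else false.

Lemma first_coord_posN d (x : 'rV[R]_d) : x != 0 ->
  first_coord_pos (- x) = ~~ first_coord_pos x.
Proof.
move=> x0; rewrite /first_coord_pos.
rewrite (eq_pick (_ : _ =1 [pred j | x ord0 j != 0])); last first.
  by move=> j; rewrite /= mxE oppr_eq0.
case: pickP => [j /= xj|xz]; first by rewrite mxE oppr_gt0 -leNgt le_eqVlt (negbTE xj).
by case/eqP: x0; apply/rowP => j; rewrite mxE; apply/eqP; move: (xz j) => /negbFE.
Qed.

Definition both_neq0 v := (v.1 != 0) && (v.2 != 0).

(** On pairs of nonzero vectors this is odd in the second vector, and in the first one it is odd or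
    even according to [odd1]. *)
Definition tie_break (odd1 : bool) v : bool :=
  (odd1 && first_coord_pos v.1) (+) first_coord_pos v.2.

(* The sign of F, with ties broken so as to keep the same equivariance. *)
Definition tie_sign (F : V -> R) (odd1 : bool) v : bool :=
  if F v == 0 then tie_break odd1 v else 0 < F v.

Lemma tie_sign_odd (F : V -> R) b v w :
  F w = - F v -> tie_break b w = ~~ tie_break b v ->
  tie_sign F b w = ~~ tie_sign F b v.
Proof.
move=> Fwv twv; rewrite /tie_sign Fwv oppr_eq0; case: ifPn => [//|F0].
by rewrite oppr_gt0 -leNgt le_eqVlt (negbTE F0).
Qed.

Lemma tie_sign_even (F : V -> R) b v w :
  F w = F v -> tie_break b w = tie_break b v ->
  tie_sign F b w = tie_sign F b v.
Proof. by move=> Fwv twv; rewrite /tie_sign Fwv; case: ifP. Qed.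

Lemma tie_sign_neq (F : V -> R) b v w : tie_sign F b v != tie_sign F b w ->
  F v * F w <= 0.
Proof.
rewrite /tie_sign; have [->|v0] := eqVneq (F v) 0; first by rewrite mul0r.
have [->|w0] := eqVneq (F w) 0; first by rewrite mulr0.
have [Fv|Fv] := ltP 0 (F v); have [Fw|Fw] := ltP 0 (F w) => //= _.
  by rewrite mulr_ge0_le0// ltW.
by rewrite mulr_le0_ge0// ltW.
Qed.

Variable F : nat -> V -> R.
Hypothesis F_even1 : forall i v, (i < m)%N -> both_neq0 v -> F i (antipode1 v) = F i v.
Hypothesis F_odd1 : forall i v, (m <= i < m + n)%N -> both_neq0 v ->
  F i (antipode1 v) = - F i v.
Hypothesis F_odd2 : forall i v, (i < m + n)%N -> both_neq0 v ->
  F i (antipode2 v) = - F i v.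

Lemma cross_simplex_neq0 s v : cross_simplex s -> v \in s -> both_neq0 v.
Proof.
move=> [a [b [_ _ abP]]] /abP[av bv _]; apply/andP; split.
  apply: contra_eq_neq av => ->; rewrite -(scale0r 0) dotvZr mul0r.
  by rewrite eq_sym oner_neq0.
apply: contra_eq_neq bv => ->; rewrite -(scale0r 0) dotvZr mul0r.
by rewrite eq_sym oner_neq0.
Qed.

(** Subdivide until the mesh is below [e]. By [cup_hemisphere], the product of the coboundaries of
    the signs is nonzero on some simplex, and there every sign changes. *)
Lemma fine_sign_change (e : R) : 0 < e ->
  exists s, [/\ cross_simplex s, mesh_le s e, s != [::] &
    forall i, (i < m + n)%N ->
      exists x y, [/\ x \in s, y \in s & F i x * F i y <= 0]].
Proof.
move=> e0.
set c : R := (n + m)%:R / (n + m).+1%:R.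
have [r cr] : exists r, c ^+ r * 2 < e.
  have c1 : `|c| < 1.
    rewrite ger0_norm ?divr_ge0// ltr_pdivrMr ?ltr0n// mul1r ltr_nat.
    exact: ltnSn.
  have /cvgrPdist_lt/(_ (e / 2)) := @cvg_expr R c c1.
  rewrite divr_gt0// => /(_ isT)[r _ /(_ r (leqnn r))]/=.
  rewrite sub0r normrN ger0_norm ?exprn_ge0 ?divr_ge0// => cr.
  by exists r; rewrite -ltr_pdivlMr.
pose fsE := mkseq (fun i => tie_sign (F i) false) m.
pose fsO := mkseq (fun i => tie_sign (F (m + i)%N) true) n.
have DZ n' m' : (n' <= size fsO)%N -> (m' <= size fsE)%N ->
    all (all both_neq0) (@fine_chain R n.+1 m.+1 r n' m').
  rewrite !size_mkseq => nn mm; apply/allP => s sP; apply/allP => v.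
  by apply: cross_simplex_neq0; apply: cross_simplex_fine sP.
have := @cup_hemisphere _ (@antipode1 R n.+1 m.+1) (@antipode2 R n.+1 m.+1)
  both_neq0 (@fine_chain R n.+1 m.+1 r) fsE fsO (fine_chains r) _ DZ.
rewrite !size_mkseq => /(_ _ _ _)/chain_evalP[|i im|i im_n|s sP cups].
- by move=> n' m' s; exact: size_fine.
- rewrite nth_mkseq//; split=> v /andP[v1 v2].
    by rewrite addbF; apply: tie_sign_even => //; rewrite F_even1//; exact/andP.
  rewrite addbT; apply: tie_sign_odd; last by rewrite /tie_break /= first_coord_posN.
  by rewrite F_odd2//; [rewrite ltn_addr|exact/andP].
- have mi : (m + i < m + n)%N by rewrite ltn_add2l.
  rewrite nth_mkseq//; split=> v /andP[v1 v2]; rewrite addbT; apply: tie_sign_odd.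
  + by rewrite F_odd1 ?leq_addr//; exact/andP.
  + by rewrite /tie_break /= first_coord_posN// addNb.
  + by rewrite F_odd2//; exact/andP.
  + by rewrite /tie_break /= first_coord_posN// addbN.
exists s; split.
- exact: cross_simplex_fine sP.
- move=> x y xs ys; apply: le_trans (ltW cr).
  by apply: mesh_fine sP _ _ xs ys.
- by move: (size_fine sP); case: (s).
move=> i imn; have := @cup_change _ _ s xpredT i cups.
rewrite size_cat !size_mkseq => /(_ imn)[x [y [xs ys xy]]].
exists x, y; split => //; move: xy; rewrite nth_cat !size_mkseq.
case: ltnP => im; first by rewrite nth_mkseq//; exact: tie_sign_neq.
by rewrite nth_mkseq ?ltn_subLR// subnKC//; exact: tie_sign_neq.
Qed.

Hypothesis F_cont : forall i (x : nat -> V) v, (i < m + n)%N -> both_neq0 v ->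
  x @ \oo --> v -> F i (x k) @[k --> \oo] --> F i v.

(** Simplices of mesh tending to 0 accumulate at a point [v] by compactness. Both ends of a sign
    change of [F i] converge to [v] along a subsequence, so the square of [F i v] is at most 0. *)
Theorem equivariant_zero : exists2 v, both_neq0 v & forall i, (i < m + n)%N -> F i v = 0.
Proof.
have k0 (k : nat) : 0 < k.+1%:R^-1 :> R by rewrite invr_gt0 ltr0n.
have /choice[s sP] (k : nat) := fine_sign_change (k0 k).
pose x k := head (0 : V) (s k).
have xs k : x k \in s k.
  by have [_ _] := sP k; rewrite /x; case: (s k) => //= ? ? _; rewrite mem_head.
pose K : set V := [set u : 'rV[R]_n.+1 | `|u| <= 1] `*` [set w : 'rV[R]_m.+1 | `|w| <= 1].
have ball_compact d : compact [set u : 'rV[R]_d | `|u| <= 1].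
  apply: bounded_closed_compact.
    by exists 1; split => // M M1 u /= u1; rewrite (le_trans u1)// ltW.
  rewrite (_ : mkset _ = Num.norm @^-1` [set r : R | r <= 1])//.
  apply: closed_comp => [u _|]; [exact: norm_continuous|exact: closed_le].
have cK : compact K by apply: compact_setX; exact: ball_compact.
have [|v [_ cl]] := cK (x @ \oo) (fmap_proper_filter x eventually_filter).
  exists 0%N => // k _ /=; have [[a [b [_ _ abP]]] _ _ _] := sP k.
  have [_ _] := abP _ (xs k); rewrite prod_normE ge_max => /andP[]; by [].
(* An explicit subsequence converging to the cluster point, with [k <= j] so that the mesh shrinks
   too. *)
have /choice[j jP] (k : nat) : exists j, (k <= j)%N /\ `|v - x j| < k.+1%:R^-1.
  have [||z [[j kj <-] vz]] := cl [set x j | j in [set j | (k <= j)%N]] (ball v k.+1%:R^-1).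
  - by exists k => // j /= kj; exists j.
  - exact: (nbhsx_ballx v _ (k0 k)).
  by exists j; split => //; move: vz; rewrite -ball_normE.
have near_v k y : y \in s (j k) -> `|v - y| <= 2 * k.+1%:R^-1.
  move=> ys; have [kj xv] := jP k; have [_ mesh _ _] := sP (j k).
  rewrite (_ : v - y = (v - x (j k)) + (x (j k) - y)); last by rewrite addrA subrK.
  rewrite mulr_natl mulr2n (le_trans (ler_normD _ _))// lerD ?(ltW xv)//.
  rewrite (le_trans (mesh _ _ (xs _) ys))// lef_pV2 ?posrE ?ltr0n// ler_nat.
  by rewrite ltnS.
have cvg_v (z : nat -> V) : (forall k, z k \in s (j k)) -> z @ \oo --> v.
  move=> zs; apply/cvgrPdist_le => e e0.
  have : 2 * (k.+1%:R^-1 : R) @[k --> \oo] --> 2 * (0 : R).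
    by apply: cvgM; [exact: cvg_cst|exact: cvg_harmonic].
  rewrite mulr0 => /cvgrPdist_le/(_ e e0); apply: filterS => k.
  rewrite sub0r normrN ger0_norm// => ke.
  exact: le_trans (near_v _ _ (zs k)) ke.
(* Each component of [x (j k)] lies on a supporting hyperplane, so [dotv_norm_ge] bounds its norm
   below by 1/d; up to the error in [near_v] the bound passes to [v]. *)
have v0 : both_neq0 v.
  have big d (u : 'rV[R]_d) :
      (forall k, 1 <= d%:R * (`|u| + 2 * (k.+1%:R^-1 : R))) -> u != 0.
    (* For [u = 0] the bound at index 2d would read 1 <= 2d/(2d+1). *)
    move=> h; apply/eqP => u0; have := h (2 * d)%N; rewrite u0 normr0 add0r.
    rewrite mulrA ler_pdivlMr ?ltr0n// mul1r -natrM ler_nat; lia.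
  have bound d (f : V -> 'rV[R]_d) (a : 'rV[R]_d) k :
      (forall i, `|a ord0 i| <= 1) -> dotv a (f (x (j k))) = 1 ->
      `|f v - f (x (j k))| <= `|v - x (j k)| ->
      1 <= d%:R * (`|f v| + 2 * (k.+1%:R^-1 : R)).
    move=> a1 /(dotv_norm_ge a1) ax fv; rewrite (le_trans ax)// ler_wpM2l//.
    rewrite -lerBlDl; apply: le_trans (near_v _ _ (xs (j k))).
    rewrite (le_trans _ fv)// distrC; exact: lerB_dist.
  apply/andP; split; apply: big => k.
    have [[a [b [a1 _ abP]]] _ _ _] := sP (j k); have [ax _ _] := abP _ (xs _).
    apply: (bound _ (fun v => v.1) a) => //.
    by rewrite [leRHS]prod_normE le_max lexx.
  have [[a [b [_ b1 abP]]] _ _ _] := sP (j k); have [_ bx _] := abP _ (xs _).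
  apply: (bound _ (fun v => v.2) b) => //.
  by rewrite [leRHS]prod_normE le_max lexx orbT.
exists v => // i imn.
have /choice[y yP] k : exists y : V * V,
    [/\ y.1 \in s (j k), y.2 \in s (j k) & F i y.1 * F i y.2 <= 0].
  have [_ _ _ /(_ i imn)[y [z [ys zs yz]]]] := sP (j k).
  by exists (y, z).
have y1 : F i (y k).1 @[k --> \oo] --> F i v.
  by apply: F_cont => //; apply: cvg_v => k; have [] := yP k.
have y2 : F i (y k).2 @[k --> \oo] --> F i v.
  by apply: F_cont => //; apply: cvg_v => k; have [] := yP k.
have : F i v * F i v <= 0.
  have y12 : F i (y k).1 * F i (y k).2 @[k --> \oo] --> F i v * F i v by exact: cvgM.
  rewrite -(cvg_lim _ y12)//.
  apply: limr_le; first by apply/cvg_ex; eexists; exact: y12.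
  by apply: nearW => k; have [] := yP k.
by rewrite -expr2 => F2; apply/eqP; rewrite -sqrf_eq0 eq_le F2 sqr_ge0.
Qed.

End SignChange.

(** * Mass of half-spaces *)

Section NullHyperplanes.
Variable R : realType.

Lemma dotv0l d (x : 'rV[R]_d) : dotv 0 x = 0.
Proof. by rewrite -(scale0r 0) dotvZl mul0r. Qed.

Lemma dotv_cvg d T (F : set_system T) {FF : Filter F}
  (u_ : T -> 'rV[R]_d) (u x : 'rV[R]_d) :
  u_ @ F --> u -> dotv (u_ k) x @[k --> F] --> dotv u x.
Proof.
move=> uu; rewrite /dotv; apply: cvg_big => [|i _]; first exact: add_continuous.
apply: cvgM; last exact: cvg_cst.
by have := cvg_comp _ _ uu (@coord_continuous _ _ _ ord0 i u).
Qed.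

Lemma dotv_continuous d (u : 'rV[R]_d) : continuous (dotv u : 'rV[R]_d -> R).
Proof.
move=> x; rewrite (_ : dotv u = fun y => dotv y u); last by apply/funext => y; exact: dotvC.
exact: (@dotv_cvg _ _ (nbhs x) _ id).
Qed.

Lemma open_measurable_Rn d (U : set (borelRn R d)) :
  @open 'rV[R]_d U -> measurable U.
Proof. exact: sub_sigma_algebra. Qed.

Lemma open_lt_dotv d (u : 'rV[R]_d) t : @open 'rV[R]_d [set x | dotv u x < t].
Proof.
rewrite (_ : mkset _ = dotv u @^-1` [set s : R | s < t])//.
by apply: open_comp => [x _|]; [exact: dotv_continuous|exact: open_lt].
Qed.

Lemma open_gt_dotv d (u : 'rV[R]_d) t : @open 'rV[R]_d [set x | t < dotv u x].
Proof.
rewrite (_ : mkset _ = dotv u @^-1` [set s : R | t < s])//.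
by apply: open_comp => [x _|]; [exact: dotv_continuous|exact: open_gt].
Qed.

Lemma measurable_hyperplane d (u : 'rV[R]_d) t :
  measurable (hyperplane u t : set (borelRn R d)).
Proof.
rewrite (_ : hyperplane u t = ~` ([set x | dotv u x < t] `|` [set x | t < dotv u x])).
  apply: measurableC; apply: measurableU; apply: open_measurable_Rn.
    exact: open_lt_dotv.
  exact: open_gt_dotv.
apply/seteqP; split => x /=; first by move=> ->; rewrite ltxx => -[].
by move/not_orP => -[/negP + /negP]; rewrite -!leNgt => a b; apply/eqP; rewrite eq_le b a.
Qed.

Lemma dotv_consRn n (u : 'rV[R]_n.+1) p :
  dotv u (consRn p) = u ord0 ord0 * p.1 + dotv (\row_i u ord0 (lift ord0 i)) p.2.
Proof.
rewrite /dotv big_ord_recl consRn0; congr (_ + _).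
by apply: eq_bigr => i _; rewrite consRnS mxE.
Qed.

(** Split off the first coordinate. If the rest [u'] of [u] is nonzero, all sections are hyperplanes
    of lower dimension, null by induction; otherwise the set is a point times the whole space. *)
Lemma lebesgue_Rn_hyperplane n (u : 'rV[R]_n) b : u != 0 ->
  lebesgue_Rn R n (hyperplane u b) = 0%E.
Proof.
elim: n u b => [|n IH] u b u0; first by rewrite thinmx0 eqxx in u0.
pose u' := \row_i u ord0 (lift ord0 i).
rewrite /= /lebesgue_Rn_step /pushforward.
have [u'0|u'0] := eqVneq u' 0; last first.
  rewrite /product_measure1 integral0_eq// => a _ /=.
  rewrite (_ : xsection _ a = hyperplane u' (b - u ord0 ord0 * a)); first exact: IH.
  apply/seteqP; split => y; rewrite /xsection/= inE /hyperplane/= dotv_consRn/= -/u'.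
    by move=> <-; rewrite addrAC subrr add0r.
  by move=> ->; rewrite addrC subrK.
have u00 : u ord0 ord0 != 0.
  apply: contra_neq u0 => u00; apply/rowP => i; rewrite mxE.
  case: (unliftP ord0 i) => [j ->|-> //].
  by have := congr1 (fun M : 'rV_n => M ord0 j) u'0; rewrite !mxE.
rewrite (_ : _ @^-1` _ = [set b / u ord0 ord0] `*` setT).
  by rewrite product_measure1E// [X in (X * _)%E](lebesgue_measure_set1 _) mul0e.
apply/seteqP; split => -[a y]; rewrite /hyperplane/= dotv_consRn/= -/u' u'0 dotv0l addr0.
  by move=> <-; rewrite mulrC mulKf.
by move=> [-> _]; rewrite mulrC divfK.
Qed.

End NullHyperplanes.

Section FiniteMeasure.
Context d (T : measurableType d) (R : realType) (mu : {finite_measure set T -> \bar R}).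

(** Dominated convergence for indicator functions, bounded by the constant 1. The continuity of
    masses and quantiles rests on it. *)
Lemma finite_measure_cvg (A : nat -> set T) (B N : set T) :
  (forall k, measurable (A k)) -> measurable B -> measurable N -> mu N = 0%E ->
  (forall x, ~ N x -> \forall k \near \oo, A k x <-> B x) ->
  fine (mu (A k)) @[k --> \oo] --> fine (mu B).
Proof.
move=> mA mB mN N0 AB; apply: fine_cvg; rewrite fineK ?fin_num_measure//.
have [] := @dominated_convergence _ _ R mu setT measurableT
  (fun k x => (\1_(A k) x)%:E) (fun x => (\1_B x)%:E) (cst 1%E).
- by move=> k; apply/measurable_EFinP; exact: measurable_indic.
- by apply/measurable_EFinP; exact: measurable_indic.
- exists N; split => // x /=; apply: contra_notP => Nx _.
  apply: cvg_near_cst.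
  apply: filterS (AB _ Nx) => k ABx; rewrite !indicE; congr ((nat_of_bool _)%:R%:E).
  by apply/idP/idP; rewrite !inE => /ABx.
- exact: finite_measure_integrable_cst.
- apply: aeW => x k _ /=; rewrite lee_fin ger0_norm// indicE.
move=> _ _; rewrite integral_indic// setIT.
by under eq_fun do rewrite integral_indic// setIT.
Qed.

End FiniteMeasure.

(** * Continuity of masses, and quantiles in a direction *)

Section Quantiles.
Variables (R : realType) (d : nat) (mu : {finite_measure set (borelRn R d) -> \bar R}).
Hypothesis hmu : mass_distribution mu.
Implicit Types (u v : 'rV[R]_d) (s t b : R) (A B : set (borelRn R d)).

Definition mass A : R := fine (mu A).

Definition below u t : set (borelRn R d) := [set x | dotv u x < t].

Lemma massE A : measurable A -> (mass A)%:E = mu A.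
Proof. by move=> mA; rewrite /mass fineK ?fin_num_measure. Qed.

Lemma measurable_below u t : measurable (below u t).
Proof. by apply: open_measurable_Rn; exact: open_lt_dotv. Qed.

Lemma mass0 : mass set0 = 0.
Proof. by rewrite /mass measure0. Qed.

Lemma massD A B : measurable A -> measurable B -> mass A = mass (A `&` B) + mass (A `\` B).
Proof.
move=> mA mB; apply: EFin_inj; rewrite EFinD !massE//.
- by rewrite addeC (measureDI mu mA mB).
- exact: measurableD.
- exact: measurableI.
Qed.

Lemma mass_ge0 A : 0 <= mass A.
Proof. exact/fine_ge0/measure_ge0. Qed.

Lemma mass_le A B : measurable A -> measurable B -> A `<=` B -> mass A <= mass B.
Proof. by move=> mA mB AB; rewrite -lee_fin !massE// le_measure ?inE. Qed.

(** The degenerate case [u = 0], where the set is empty, is included because a half-space encoded by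
    a nonzero vector of R^(d+1) may be everything or nothing. *)
Lemma mu_hyperplane u t : (u != 0) || (t != 0) -> mu (hyperplane u t) = 0%E.
Proof.
have [->/= t0|u0 _] := eqVneq u 0.
  rewrite (_ : hyperplane 0 t = set0) ?measure0//.
  by apply/seteqP; split => // x; rewrite /hyperplane/= dotv0l => e; rewrite e eqxx in t0.
have [[f [fi muE]] _] := hmu; rewrite muE; last exact: measurable_hyperplane.
apply: null_set_integral; first exact: measurable_hyperplane.
  apply: measurable_funS (measurable_int _ fi) => //.
exact: lebesgue_Rn_hyperplane.
Qed.

Lemma mass_eq_off_hyperplane A B u t : (u != 0) || (t != 0) ->
  measurable A -> measurable B ->
  (forall x, dotv u x != t -> A x <-> B x) -> mass A = mass B.
Proof.
move=> ut mA mB AB; have mH := measurable_hyperplane u t.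
have H0 (C : set (borelRn R d)) : measurable C -> mass (C `&` hyperplane u t) = 0.
  move=> mC; apply/eqP; rewrite eq_le mass_ge0 andbT.
  rewrite (le_trans (mass_le _ mH _))//; first exact: measurableI.
  by rewrite /mass mu_hyperplane.
rewrite (massD mA mH) (massD mB mH) !H0//; congr (_ + mass _).
by apply/seteqP; split => x [Cx /= Hx]; split => //; apply/(AB x) => //; apply/eqP.
Qed.

Lemma mass_belowN A v b : (v != 0) || (b != 0) -> measurable A ->
  mass (A `&` below (- v) (- b)) = mass A - mass (A `&` below v b).
Proof.
move=> vb mA; rewrite (massD mA (measurable_below v b)) addrAC subrr add0r.
apply: (mass_eq_off_hyperplane vb).
- by apply: measurableI => //; exact: measurable_below.
- by apply: measurableD => //; exact: measurable_below.
move=> x xb; rewrite /below/= dotvNl ltrN2; split => -[Ax].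
  by move=> bx; split => //= xb'; move: (lt_trans bx xb'); rewrite ltxx.
by move=> /negP; rewrite -leNgt le_eqVlt eq_sym (negbTE xb).
Qed.

Lemma near_below (u_ : nat -> 'rV[R]_d) u (t_ : nat -> R) t (x : 'rV[R]_d) :
  u_ @ \oo --> u -> t_ @ \oo --> t -> dotv u x != t ->
  \forall k \near \oo, below (u_ k) (t_ k) x <-> below u t x.
Proof.
move=> uu tt.
have c : t_ k - dotv (u_ k) x @[k --> \oo] --> t - dotv u x.
  by apply: cvgB => //; exact: dotv_cvg.
rewrite /below/= neq_lt => /orP[xt|tx].
  have : \forall k \near \oo, 0 < t_ k - dotv (u_ k) x.
    by apply: (cvgr_gt _ c); rewrite subr_gt0.
  by apply: filterS => k; rewrite subr_gt0 xt.
have : \forall k \near \oo, t_ k - dotv (u_ k) x < 0.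
  by apply: (cvgr_lt _ c); rewrite subr_lt0.
apply: filterS => k; rewrite subr_lt0 => /ltW; rewrite leNgt => /negbTE ->.
by rewrite (ltNge _ t) (ltW tx).
Qed.

Lemma mass_belowI_cvg (u_ : nat -> 'rV[R]_d) u (t_ : nat -> R) t
    (v_ : nat -> 'rV[R]_d) v (b_ : nat -> R) b :
  (u != 0) || (t != 0) -> (v != 0) || (b != 0) ->
  u_ @ \oo --> u -> t_ @ \oo --> t -> v_ @ \oo --> v -> b_ @ \oo --> b ->
  mass (below (u_ k) (t_ k) `&` below (v_ k) (b_ k)) @[k --> \oo] -->
  mass (below u t `&` below v b).
Proof.
move=> ut vb uu tt vv bb.
have mI u' t' v' b' : measurable (below u' t' `&` below v' b').
  by apply: measurableI; exact: measurable_below.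
apply: (@finite_measure_cvg _ _ _ mu _ _ (hyperplane u t `|` hyperplane v b)) => //.
- by apply: measurableU; exact: measurable_hyperplane.
- by rewrite null_set_setU//; [exact: measurable_hyperplane|
    exact: measurable_hyperplane|exact: mu_hyperplane|exact: mu_hyperplane].
move=> x /not_orP[/eqP xu /eqP xv].
have := near_below uu tt xu; have := near_below vv bb xv.
by apply: filterS2 => k e1 e2; split => -[/e2 ? /e1 ?].
Qed.

(** With the whole space as a degenerate half-space, results on two half-spaces specialize to
    one. *)
Lemma below01 : below 0 1 = setT.
Proof. by apply/seteqP; split => // x _; rewrite /below/= dotv0l ltr01. Qed.

Lemma mass_below_cvg (u_ : nat -> 'rV[R]_d) u (t_ : nat -> R) t :
  (u != 0) || (t != 0) -> u_ @ \oo --> u -> t_ @ \oo --> t ->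
  mass (below (u_ k) (t_ k)) @[k --> \oo] --> mass (below u t).
Proof.
move=> ut uu tt; rewrite -[below u t]setIT -below01.
under eq_fun do rewrite -[below _ _]setIT -below01.
apply: mass_belowI_cvg => //; try exact: cvg_cst.
by rewrite oner_neq0 orbT.
Qed.

Lemma mass_below_le u s t : s <= t -> mass (below u s) <= mass (below u t).
Proof.
move=> st; apply: mass_le; try exact: measurable_below.
by move=> x; rewrite /below/= => /lt_le_trans; apply.
Qed.

Lemma dotv_gt0 u : u != 0 -> 0 < dotv u u.
Proof.
move=> u0; have nn i : true -> 0 <= u ord0 i * u ord0 i by rewrite -expr2 sqr_ge0.
rewrite lt_neqAle sumr_ge0// andbT eq_sym; apply: contra_neq u0 => uu0.
apply/rowP => i; rewrite mxE; apply/eqP; rewrite -sqrf_eq0 expr2; apply/eqP.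
by apply: (psumr_eq0P nn uu0).
Qed.

(** The open slab between the two levels is nonempty, so it has positive mass. This makes quantiles
    unique. *)
Lemma mass_below_lt u s t : u != 0 -> s < t -> mass (below u s) < mass (below u t).
Proof.
move=> u0 st; rewrite (massD (measurable_below u t) (measurable_below u s)).
rewrite (_ : below u t `&` below u s = below u s); last first.
  by apply/setIidPr => x; rewrite /below/= => /lt_trans; apply.
rewrite ltrDl; set S := [set x : 'rV[R]_d | dotv u x < t] `&` [set x | s < dotv u x].
have oS : open S by apply: openI; [exact: open_lt_dotv|exact: open_gt_dotv].
have mS : measurable (S : set (borelRn R d)) by exact: open_measurable_Rn.
apply: (@lt_le_trans _ _ (mass S)).
  rewrite -lte_fin massE//; apply: hmu.2 => //.
  exists (((s + t) / 2 / dotv u u) *: u); rewrite /S/= dotvZr divfK ?gt_eqF ?dotv_gt0//.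
  by split; [rewrite midf_lt|rewrite midf_lt].
apply: mass_le => //; first by apply: measurableD; exact: measurable_below.
move=> x [/= xt sx]; split => //=; rewrite /below/= => xs.
by move: (lt_trans xs sx); rewrite ltxx.
Qed.

Lemma mass_below_ex u (a : R) : u != 0 -> 0 < a < mass setT ->
  exists t, mass (below u t) = a.
Proof.
move=> u0 /andP[a0 aM].
have [k1 k1a] : exists k : nat, a < mass (below u k%:R).
  have : mass (below u k%:R) @[k --> \oo] --> mass setT.
    apply: (@finite_measure_cvg _ _ _ mu _ _ set0) => //.
      by move=> k; exact: measurable_below.
    move=> x _; exists (Num.truncn (`|dotv u x|)).+1 => // k /= kx; split => // _.
    rewrite /below/= (le_lt_trans (ler_norm _))// (lt_le_trans (truncnS_gt _))//.
    by rewrite ler_nat.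
  by move=> /(cvgr_gt _)/(_ a aM)[k _ /(_ k (leqnn k))]; exists k.
have [k2 k2a] : exists k : nat, mass (below u (- k%:R)) < a.
  have : mass (below u (- k%:R)) @[k --> \oo] --> mass set0.
    apply: (@finite_measure_cvg _ _ _ mu _ _ set0) => //.
      by move=> k; exact: measurable_below.
    move=> x _; exists (Num.truncn (`|dotv u x|)).+1 => // k /= kx; split => //.
    rewrite /below/= ltrNr => /(le_lt_trans _) kx'.
    have := lt_le_trans (truncnS_gt `|dotv u x|) (_ : _ <= k%:R); rewrite ler_nat => /(_ kx).
    move=> /lt_trans/(_ (kx' _ (lexx _))); rewrite -normrN ltNge ler_norm//.
  by rewrite mass0 => /(cvgr_lt _)/(_ a a0)[k _ /(_ k (leqnn k))]; exists k.
have kk : - k2%:R <= k1%:R :> R by rewrite (le_trans _ (ler0n _ _))// oppr_le0.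
have [|||t _ ta] := @IVT R (fun t => mass (below u t)) (- k2%:R) k1%:R a => //.
- apply: continuous_subspaceT => t; apply/(@cvg_nbhsP _ R^o) => t_ tt.
  by apply: mass_below_cvg => //; [rewrite u0|exact: cvg_cst].
- by rewrite ge_min le_max (ltW k2a) (ltW k1a) orbT.
- by exists t.
Qed.

Definition quantile u (a : R) : R := xget 0 [set t | mass (below u t) = a].

Lemma quantileP u (a : R) : u != 0 -> 0 < a < mass setT ->
  mass (below u (quantile u a)) = a.
Proof.
move=> u0 aM; have [t ta] := mass_below_ex u0 aM.
by rewrite /quantile; case: xgetP => //= /(_ t).
Qed.

Lemma quantile_lt u (a b : R) : u != 0 -> 0 < a < mass setT -> 0 < b < mass setT ->
  a < b -> quantile u a < quantile u b.
Proof.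
move=> u0 aM bM; rewrite -{1}(quantileP u0 aM) -{1}(quantileP u0 bM).
by apply: contraTT; rewrite -!leNgt; exact: mass_below_le.
Qed.

Lemma quantile_unique u (a t : R) : u != 0 -> 0 < a < mass setT ->
  mass (below u t) = a -> quantile u a = t.
Proof.
move=> u0 aM ta; have qa := quantileP u0 aM.
by have [qt|qt|//] := ltgtP (quantile u a) t; have := mass_below_lt u0 qt;
  rewrite qa ta ltxx.
Qed.

Lemma quantileN u (a : R) : u != 0 -> 0 < a < mass setT ->
  quantile (- u) a = - quantile u (mass setT - a).
Proof.
move=> u0 aM; apply: quantile_unique; rewrite ?oppr_eq0//.
have := @mass_belowN setT u (quantile u (mass setT - a)).
rewrite !setTI => ->//; last by rewrite u0.
rewrite quantileP// ?subKr//; move: aM; lra.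
Qed.

(** By strict monotonicity, the masses below the levels [quantile u a - e] and [quantile u a + e]
    lie on either side of [a]; by continuity they still do for nearby directions. *)
Lemma quantile_cvg (u_ : nat -> 'rV[R]_d) u (a : R) : u != 0 -> 0 < a < mass setT ->
  u_ @ \oo --> u -> quantile (u_ k) a @[k --> \oo] --> quantile u a.
Proof.
move=> u0 aM uu; apply/cvgrPdist_lt => e e0.
have mb t : mass (below (u_ k) t) @[k --> \oo] --> mass (below u t).
  by apply: mass_below_cvg => //; [rewrite u0|exact: cvg_cst].
have qa := quantileP u0 aM.
have lo : \forall k \near \oo, mass (below (u_ k) (quantile u a - e)) < a.
  by apply: (cvgr_lt _ (mb _)); rewrite -[ltRHS]qa mass_below_lt// ltrBlDr ltrDl.
have hi : \forall k \near \oo, a < mass (below (u_ k) (quantile u a + e)).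
  by apply: (cvgr_gt _ (mb _)); rewrite -[ltLHS]qa mass_below_lt// ltrDl.
have un0 : \forall k \near \oo, u_ k != 0 by exact: cvgr_neq0 uu u0.
near=> k; have uk : u_ k != 0 by near: k.
rewrite ltr_distlC; apply/andP; split.
  rewrite ltNge; apply/negP => /(mass_below_le (u_ k)).
  by rewrite quantileP// leNgt => /negP; apply; near: k.
rewrite ltNge; apply/negP => /(mass_below_le (u_ k)).
by rewrite quantileP// leNgt => /negP; apply; near: k.
Unshelve. all: by end_near. Qed.

End Quantiles.

(** * Discrepancies of the slabs *)

Section TestMap.
Variables (R : realType) (n : nat).
Variable mu : {finite_measure set (borelRn R n.+1) -> \bar R}.
Hypothesis hmu : mass_distribution mu.
Let V : normedModType R := ('rV[R]_n.+1 * 'rV[R]_n.+2)%type.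
Implicit Types (x v : V) (w : 'rV[R]_n.+2).
(** The number 2d - 1 of slabs, where d = n + 1. *)
Let N := (2 * n).+1.
Let M := mass mu setT.

(* A vector w of R^(d+1) encodes the half-space dotv (normal w) x < w_0. *)
Definition normal w : 'rV[R]_n.+1 := \row_i w ord0 (lift ord0 i).

Definition neg_side w := below (normal w) (w ord0 ord0).

Lemma normalN w : normal (- w) = - normal w.
Proof. by apply/rowP => i; rewrite !mxE. Qed.

Lemma normal_neq0 w : w != 0 -> (normal w != 0) || (w ord0 ord0 != 0).
Proof.
apply: contra_neqT; rewrite negb_or !negbK => /andP[/eqP w1 /eqP w0].
apply/rowP => i; rewrite mxE; case: (unliftP ord0 i) => [j ->|-> //].
by have := congr1 (fun A : 'rV_n.+1 => A ord0 j) w1; rewrite !mxE.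
Qed.

Lemma normal_cvg (w_ : nat -> 'rV[R]_n.+2) w :
  w_ @ \oo --> w -> normal (w_ k) @[k --> \oo] --> normal w.
Proof.
move=> /cvgrPdist_le ww; apply/cvgrPdist_le => e e0; apply: filterS (ww e e0) => k.
apply: le_trans; apply: mx_norm_le => // i; rewrite !mxE.
by have := mx_norm_coord (w - w_ k) (lift ord0 i); rewrite !mxE.
Qed.

Definition level (j : nat) : R := j%:R / N%:R * M.

Lemma mass_gt0 : 0 < M.
Proof.
rewrite -lte_fin massE//; apply: hmu.2; first exact: openT.
by exists 0.
Qed.

Lemma level_in j : (0 < j < N)%N -> 0 < level j < M.
Proof.
move=> /andP[j0 jN]; have M0 := mass_gt0.
rewrite mulr_gt0 ?divr_gt0 ?ltr0n//= -ltr_pdivlMr// divff ?gt_eqF//.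
by rewrite ltr_pdivrMr ?ltr0n// mul1r ltr_nat.
Qed.

Lemma level_compl j : (j <= N)%N -> M - level j = level (N - j).
Proof.
move=> jN; rewrite /level natrB//; have : N%:R != 0 :> R by rewrite pnatr_eq0.
by move=> ?; field.
Qed.

Lemma levelN : level N = M.
Proof. by rewrite /level divff ?mul1r// pnatr_eq0. Qed.

(** Discrepancies are cumulated over the first [j] slabs; those of single slabs are successive
    differences. *)
Definition excess j x : R :=
  mass mu (below x.1 (quantile mu x.1 (level j)) `&` neg_side x.2) - level j / 2.

Definition total_excess x : R := mass mu (neg_side x.2) - M / 2.

Lemma mass_neg_sideN w (A : set (borelRn R n.+1)) : w != 0 -> measurable A ->
  mass mu (A `&` neg_side (- w)) = mass mu A - mass mu (A `&` neg_side w).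
Proof. by move=> w0 mA; rewrite /neg_side normalN mxE mass_belowN//; exact: normal_neq0. Qed.

Lemma excess_antipode2 j x : (0 < j < N)%N -> both_neq0 x ->
  excess j (antipode2 x) = - excess j x.
Proof.
move=> jN /andP[x1 x2]; rewrite /excess/= mass_neg_sideN//; last exact: measurable_below.
by rewrite quantileP//; [lra|exact: level_in].
Qed.

Lemma total_excess_antipode2 x : both_neq0 x ->
  total_excess (antipode2 x) = - total_excess x.
Proof.
move=> /andP[x1 x2]; rewrite /total_excess/=.
by have := mass_neg_sideN x2 measurableT; rewrite !setTI => ->; rewrite -/M; lra.
Qed.

(** Reversing the direction turns the first [j] slabs into the last [j], which are the complement of
    the first [N - j]. *)
Lemma excess_antipode1 j x : (0 < j < N)%N -> both_neq0 x ->
  excess j (antipode1 x) = total_excess x - excess (N - j) x.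
Proof.
move=> jN /andP[x1 x2]; rewrite /excess /total_excess/= quantileN//; last exact: level_in.
have jN' : (j <= N)%N by case/andP: jN => _ /ltnW.
have lj := level_compl jN'; rewrite -/M lj setIC mass_belowN//.
- by rewrite setIC; lra.
- by rewrite x1.
- exact: measurable_below.
Qed.

Lemma neg_side_cvg (x_ : nat -> V) v : both_neq0 v -> x_ @ \oo --> v ->
  mass mu (neg_side (x_ k).2) @[k --> \oo] --> mass mu (neg_side v.2).
Proof.
move=> /andP[v1 v2] xv.
have w_ : (x_ k).2 @[k --> \oo] --> v.2 by apply: cvg_comp xv _; exact: cvg_snd.
apply: mass_below_cvg => //; [exact: normal_neq0|exact: normal_cvg|].
by have := cvg_comp _ _ w_ (@coord_continuous _ _ _ ord0 ord0 v.2).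
Qed.

Lemma excess_cvg j (x_ : nat -> V) v : (0 < j < N)%N -> both_neq0 v -> x_ @ \oo --> v ->
  excess j (x_ k) @[k --> \oo] --> excess j v.
Proof.
move=> jN /andP[v1 v2] xv.
have u_ : (x_ k).1 @[k --> \oo] --> v.1 by apply: cvg_comp xv _; exact: cvg_fst.
have w_ : (x_ k).2 @[k --> \oo] --> v.2 by apply: cvg_comp xv _; exact: cvg_snd.
apply: cvgB; last exact: cvg_cst.
apply: mass_belowI_cvg => //.
- by rewrite v1.
- exact: normal_neq0.
- by apply: quantile_cvg => //; exact: level_in.
- exact: normal_cvg.
by have := cvg_comp _ _ w_ (@coord_continuous _ _ _ ord0 ord0 v.2).
Qed.

(* Reversing the first vector exchanges the levels j and N - j, so sums and
   differences over such pairs have a definite parity. *)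
Definition test_map i x : R :=
  if i == 0%N then total_excess x
  else if (i <= n)%N then excess i x - excess (N - i) x
  else excess (i - n) x + excess (N - (i - n)) x - total_excess x.

(** The n + 1 test maps of index at most [n] are even in the first vector, the other [n] odd,
    matching the spheres of dimensions n and n + 1. At a common zero the maps [j] and [j + n] kill
    the difference and the sum of the excesses at [j] and [N - j]; such pairs exhaust the levels,
    [N] being odd. *)
Lemma halving_hyperplane : exists2 x, both_neq0 x &
  total_excess x = 0 /\ forall j, (0 < j < N)%N -> excess j x = 0.
Proof.
have NK j : (0 < j < N)%N -> (0 < N - j < N)%N by rewrite /N; lia.
have NNK j : (0 < j < N)%N -> (N - (N - j) = j)%N by rewrite /N; lia.
have te1 x : total_excess (antipode1 x) = total_excess x by [].
have [||||x x0 xP] := @equivariant_zero R n n.+1 test_map.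
- move=> i x im x0; rewrite /test_map te1; case: eqP => // /eqP i0.
  have iN : (0 < i < N)%N by rewrite /N; lia.
  rewrite (_ : (i <= n)%N = true); last by lia.
  by rewrite !excess_antipode1 ?NNK//; [lra|exact: NK].
- move=> i x im x0; rewrite /test_map te1.
  rewrite (_ : (i == 0)%N = false); last by lia.
  rewrite (_ : (i <= n)%N = false); last by lia.
  have iN : (0 < i - n < N)%N by rewrite /N; lia.
  by rewrite !excess_antipode1 ?NNK//; [lra|exact: NK].
- move=> i x im x0; rewrite /test_map total_excess_antipode2//.
  case: eqP => // /eqP i0; case: leqP => iN.
    by rewrite !excess_antipode2//; [lra|rewrite /N; lia|rewrite /N; lia].
  by rewrite !excess_antipode2//; [lra|rewrite /N; lia|rewrite /N; lia].
- move=> i x_ v im v0 xv.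
  have te : total_excess (x_ k) @[k --> \oo] --> total_excess v.
    by apply: cvgB; [exact: neg_side_cvg|exact: cvg_cst].
  rewrite /test_map; case: eqP => // /eqP i0; case: leqP => iN.
    by apply: cvgB; apply: excess_cvg => //; rewrite /N; lia.
  apply: cvgB => //; apply: cvgD; apply: excess_cvg => //; rewrite /N; lia.
have t0 : total_excess x = 0 by rewrite -[LHS]/(test_map 0%N x) xP.
have low j : (0 < j <= n)%N -> excess j x = 0 /\ excess (N - j) x = 0.
  move=> jn; have := xP j; rewrite /test_map.
  rewrite (_ : (j == 0)%N = false); last by lia.
  rewrite (_ : (j <= n)%N = true); last by lia.
  move=> h1; have {}h1 : excess j x - excess (N - j) x = 0 by apply: h1; lia.
  have := xP (j + n)%N; rewrite /test_map addnK.
  rewrite (_ : (j + n == 0)%N = false); last by lia.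
  rewrite (_ : (j + n <= n)%N = false); last by lia.
  move=> h2.
  have {}h2 : excess j x + excess (N - j) x - total_excess x = 0 by apply: h2; lia.
  by move: h1 h2; rewrite t0; split; lra.
exists x => //; split => // j jN; have [jn|jn] := leqP j n.
  by have [] := low j; first by lia.
have [|_] := low (N - j)%N; first by rewrite /N in jN *; lia.
by rewrite NNK.
Qed.

End TestMap.

(** * Masses of the boxes *)

Section Boxes.
Variables (R : realType) (n : nat).
Variable mu : {finite_measure set (borelRn R n.+1) -> \bar R}.
Hypothesis hmu : mass_distribution mu.
Let N := (2 * n).+1.
Let M := mass mu setT.
Variable u : 'rV[R]_n.+1.
Hypothesis u0 : u != 0.
Let cut j := quantile mu u (level mu j).

Lemma cut_lt i j : (0 < i)%N -> (i < j < N)%N -> cut i < cut j.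
Proof.
move=> i0 /andP[ij jN]; apply: quantile_lt => //.
- by apply: level_in; rewrite ?i0 ?(ltn_trans ij).
- by apply: level_in; rewrite ?(ltn_trans i0).
by rewrite /level ltr_pM2r ?mass_gt0// ltr_pM2r ?invr_gt0 ?ltr0n// ltr_nat.
Qed.

(** The cuts increase, so only the two neighbouring ones matter. The hyperplanes are numbered from 0
    and the cuts from 1, which puts region [k] between [cut k] and [cut k.+1]. *)
Lemma regionE l (k : 'I_l.+1) : l.+1 = N -> region u (fun i : 'I_l => cut i.+1) k =
  [set x | ((k < l)%N -> dotv u x < cut k.+1) /\ ((0 < k)%N -> cut k < dotv u x)].
Proof.
move=> lN; apply/seteqP; split => x /=.
  move=> xk; split=> [kl|k0]; first by have := xk (Ordinal kl); rewrite /= ltnn.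
  have kl : (k.-1 < l)%N by have := ltn_ord k; lia.
  by have := xk (Ordinal kl); rewrite /= prednK// leqnn.
move=> [xk kx] i; have iN : (i.+1 < N)%N by rewrite -lN ltnS.
case: ltnP => ik.
  have k0 : (0 < k)%N by lia.
  apply: le_lt_trans (kx k0); move: ik; rewrite leq_eqVlt => /predU1P[->//|ik].
  by apply/ltW/cut_lt => //; rewrite ik -lN ltn_ord.
have kl : (k < l)%N by rewrite (leq_ltn_trans ik).
apply: (lt_le_trans (xk kl)); move: ik; rewrite leq_eqVlt => /predU1P[->//|ik].
by apply/ltW/cut_lt => //; rewrite iN andbT ltnS.
Qed.

Lemma mass_region l (k : 'I_l.+1) (B : set (borelRn R n.+1)) :
  l.+1 = N -> measurable B ->
  mass mu B = M / 2 ->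
  (forall j, (0 < j < N)%N -> mass mu (below u (cut j) `&` B) = level mu j / 2) ->
  measurable (region u (fun i : 'I_l => cut i.+1) k `&` B : set (borelRn R n.+1)) /\
  mass mu (region u (fun i : 'I_l => cut i.+1) k `&` B) = M / (2 * N%:R).
Proof.
move=> lN mB MB half; rewrite regionE//.
set S := mkset _.
(* The last slab has no upper cut; taking the whole space at [N] makes every slab a difference of
   consecutive sets [T]. *)
pose T j : set (borelRn R n.+1) := if (j < N)%N then below u (cut j) else setT.
have mT j : measurable (T j) by rewrite /T; case: ifP => // _; exact: measurable_below.
have TB j : (0 < j <= N)%N -> mass mu (T j `&` B) = level mu j / 2.
  move=> /andP[j0 jN]; rewrite /T; case: ltnP => jN'; first by rewrite half// j0.
  have -> : j = N by lia.
  by rewrite setTI MB levelN.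
have kN : (k < N)%N by rewrite -lN; exact: ltn_ord.
have TkS x : T k.+1 x <-> ((k < l)%N -> dotv u x < cut k.+1).
  rewrite /T -{1}lN ltnS; case: ltnP => kl; first by split => // /(_ isT).
  by split.
have mS : measurable (S : set (borelRn R n.+1)).
  have [k0|k0] := posnP k.
    rewrite (_ : S = T k.+1)//; apply/seteqP; split => x /=; first by case=> /TkS.
    by move=> /TkS h; split => //; rewrite k0.
  rewrite (_ : S = T k.+1 `&` [set x | cut k < dotv u x]).
    by apply: measurableI => //; apply: open_measurable_Rn; exact: open_gt_dotv.
  apply/seteqP; split => x /=; first by case=> /TkS h1 /(_ k0).
  by case=> /TkS h1 h2; split.
split; first exact: measurableI.
have N0 : N%:R != 0 :> R by rewrite pnatr_eq0.
have [k0|k0] := posnP k.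
  rewrite (_ : S `&` B = T k.+1 `&` B).
    by rewrite TB ?kN// /level k0 -/N -/M; field.
  congr (_ `&` _); apply/seteqP; split => x /=; first by case=> /TkS.
  by move=> /TkS h; split => //; rewrite k0.
have kk : T k = below u (cut k) by rewrite /T kN.
have sT : T k `<=` T k.+1.
  rewrite kk /T; case: ifP => // kN' x; rewrite /below/= => /lt_trans; apply.
  by apply: cut_lt => //; rewrite kN' leqnn.
have mTB : measurable (T k.+1 `&` B) by exact: measurableI.
have := massD mu mTB (mT k).
rewrite (_ : T k.+1 `&` B `&` T k = T k `&` B); last first.
  by rewrite setIAC setIC (setIidr sT) setIC.
rewrite !TB ?k0 ?kN ?(ltnW kN)//.
rewrite (_ : mass mu (_ `\` _) = mass mu (S `&` B)).
  rewrite /level -/N -/M -natr1 => e.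
  have {}e : mass mu (S `&` B) = M / N%:R / 2 by move: e; lra.
  by rewrite e; field.
(* The difference of the sets [T] contains the hyperplane at [cut k], which the open region
   omits. *)
apply: (mass_eq_off_hyperplane hmu (u := u) (t := cut k)).
- by rewrite u0.
- exact: measurableD.
- exact: measurableI.
move=> x xk; rewrite /S/= kk /below; split => /=.
  move=> [[/TkS Tx Bx] /negP]; rewrite -leNgt => kx; split => //; split => // _.
  by rewrite lt_neqAle eq_sym xk.
move=> [[/TkS Tx kx] Bx]; split => //; apply/negP; rewrite -leNgt.
exact/ltW/kx.
Qed.

End Boxes.

(** * The additional hyperplane is transversal to the cuts *)

Section Transversal.
Variable R : realType.

(** Moving along the component [y] of [v] orthogonal to [u] stays in the hyperplane, so
    [dotv v y = 0]; then [dotv y y = 0]. *)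
Lemma hyperplane_eq_proportional d (u v : 'rV[R]_d) t b : u != 0 ->
  hyperplane v b = hyperplane u t -> exists a, v = a *: u /\ b = a * t.
Proof.
move=> u0 vu; have uu := dotv_gt0 u0; pose x0 := (t / dotv u u) *: u.
have ux0 : dotv u x0 = t by rewrite dotvZr divfK// gt_eqF.
have vx0 : dotv v x0 = b.
  by have : hyperplane u t x0 by []; rewrite -vu.
pose a := dotv v u / dotv u u; pose y := v - a *: u.
have uy : dotv u y = 0.
  by rewrite /y dotvDr dotvNr dotvZr divfK ?gt_eqF// (dotvC u) subrr.
have vy : dotv v y = 0.
  have : hyperplane u t (x0 + y) by rewrite /hyperplane/= dotvDr ux0 uy addr0.
  rewrite -vu /hyperplane/= dotvDr vx0 => h.
  by apply: (addrI b); rewrite h addr0.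
have y0 : y = 0.
  apply/eqP; apply: contraT => /dotv_gt0.
  by rewrite {1}/y dotvDl dotvNl dotvZl vy uy mulr0 subr0 ltxx.
have va : v = a *: u by apply/eqP; rewrite -subr_eq0; exact/eqP.
by exists a; split => //; rewrite -vx0 va dotvZl ux0.
Qed.

(** If parallel, the second hyperplane is a level [t] of [u], and its sides are those above and
    below [t]. A point above [t] lies before the first cut and a point below [t] after the last one,
    which is contradictory. *)
Lemma boxes_not_parallel d l (u v : 'rV[R]_d) (c : 'I_l -> R) b : u != 0 ->
  (forall i j : 'I_l, (i < j)%N -> c i < c j) ->
  (forall k s, box u c v b k s !=set0) ->
  forall i, ~ parallel (hyperplane u (c i)) (hyperplane v b).
Proof.
move=> u0 cm ne i [w vw].
have vu : hyperplane v b = hyperplane u (c i + dotv u w).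
  rewrite vw; apply/seteqP; split => x; rewrite /hyperplane/=.
    by move=> [y <- <-]; rewrite dotvDr.
  by move=> ux; exists (x - w); rewrite ?subrK// dotvDr dotvNr ux addrK.
move: vu; set t := c i + _ => vu; have [a [va ba]] := hyperplane_eq_proportional u0 vu.
have l0 : (0 < l)%N by apply: leq_ltn_trans (ltn_ord i).
pose i0 := Ordinal l0; have lp : (l.-1 < l)%N by rewrite prednK.
pose i1 := Ordinal lp.
have c01 : c i0 <= c i1.
  have [e|ne0] := posnP l.-1; last exact/ltW/cm.
  by rewrite (_ : i0 = i1)//; apply: val_inj.
have lt0 s : exists2 x, halfspace v b s x & dotv u x < c i0.
  by have [x [xr xh]] := ne ord0 s; exists x => //; have := xr i0.
have gt1 s : exists2 x, halfspace v b s x & c i1 < dotv u x.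
  by have [x [xr xh]] := ne ord_max s; exists x => //; have := xr i1; rewrite /= lp.
have key (s : bool) : (forall x, halfspace v b s x -> t < dotv u x) ->
    (forall x, halfspace v b (~~ s) x -> dotv u x < t) -> False.
  move=> h1 h2; have [x /h1 tx xc] := lt0 s; have [y /h2 yt cy] := gt1 (~~ s).
  by have := lt_trans (lt_le_trans (lt_trans tx xc) c01) (lt_trans cy yt); rewrite ltxx.
have [a0|a0|a0] := ltgtP a 0.
- apply: (key false) => x; rewrite /halfspace/= va ba dotvZl.
    by rewrite ltr_nM2l.
  by rewrite ltr_nM2l.
- apply: (key true) => x; rewrite /halfspace/= va ba dotvZl.
    by rewrite ltr_pM2l.
  by rewrite ltr_pM2l.
have [x] := lt0 true; rewrite /halfspace/= va ba dotvZl a0 !mul0r ltxx//.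
Qed.

End Transversal.

Theorem theorem3p1 (R : realType) (d : nat) (hd : (1 <= d)%N)
    (mu : {finite_measure set (borelRn R d) -> \bar R})
    (hmu : mass_distribution mu) :
  exists (u : 'rV[R]_d) (c : 'I_(2 * d - 2) -> R) (v : 'rV[R]_d) (b : R),
    [/\ u != 0 /\ v != 0,
        forall i j : 'I_(2 * d - 2), (i < j)%N -> c i < c j,
        forall i : 'I_(2 * d - 2),
          ~ parallel (hyperplane u (c i)) (hyperplane v b) &
        forall (k : 'I_(2 * d - 2).+1) (s : bool),
          mu (box u c v b k s) =
            ((4 * d - 2)%N%:R^-1%:E * mu [set: borelRn R d])%E].
Proof.
case: d hd mu hmu => [//|n] _ mu hmu.
have [[u w] /andP[/= u0 w0] [tot exc]] := halving_hyperplane hmu.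
pose c (i : 'I_(2 * n.+1 - 2)) := quantile mu u (level mu i.+1).
pose v := normal w; pose b := w ord0 ord0.
have lN : (2 * n.+1 - 2).+1 = (2 * n).+1 by lia.
have cm (i j : 'I_(2 * n.+1 - 2)) : (i < j)%N -> c i < c j.
  by move=> ij; apply: cut_lt => //; rewrite ltnS ij/= -lN ltnS.
have vb := normal_neq0 w0.
have side (s : bool) : exists B : set (borelRn R n.+1), [/\ measurable B,
    halfspace v b s = B, mass mu B = mass mu setT / 2 &
    forall j, (0 < j < (2 * n).+1)%N ->
      mass mu (below u (quantile mu u (level mu j)) `&` B) = level mu j / 2].
  case: s; last first.
    exists (neg_side w); split=> //; first exact: measurable_below.
      by move: tot; rewrite /total_excess/=; lra.
    by move=> j /exc; rewrite /excess/=; lra.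
  (* The half-space for [true] is the open opposite side, encoded by [- w]. *)
  exists (neg_side (- w)); split=> //; first exact: measurable_below.
  - by apply/seteqP; split => x; rewrite /neg_side /below/= normalN mxE dotvNl ltrN2.
  - have := mass_neg_sideN hmu w0 measurableT; rewrite !setTI => ->.
    by move: tot; rewrite /total_excess/=; lra.
  move=> j jN; rewrite mass_neg_sideN//; last exact: measurable_below.
  rewrite quantileP//; last exact: level_in.
  by have := exc _ jN; rewrite /excess/=; lra.
have boxE (k : 'I_(2 * n.+1 - 2).+1) (s : bool) : mu (box u c v b k s) =
    ((4 * n.+1 - 2)%N%:R^-1%:E * mu [set: borelRn R n.+1])%E.
  have [B [mB hB MB half]] := side s; rewrite /box hB.
  have [mS MS] := mass_region hmu u0 k lN mB MB half.
  rewrite -massE// MS -massE// -EFinM; congr _%:E.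
  have -> : (4 * n.+1 - 2)%N = (2 * (2 * n).+1)%N by lia.
  by rewrite natrM mulrC.
(* Equal shares of a positive total mass are positive, so no box is empty. *)
have ne k s : box u c v b k s !=set0.
  apply/set0P; apply/eqP => e; have := boxE k s; rewrite e measure0 -massE// -EFinM.
  move=> -[] /esym/eqP; rewrite mulf_eq0 invr_eq0 pnatr_eq0.
  rewrite (gt_eqF (mass_gt0 hmu)) orbF; lia.
exists u, c, v, b; split => //; last exact: boxes_not_parallel.
(* So far only [w != 0] is known, so [v = 0] with [b != 0] remains possible; nonempty boxes on both
   sides would then require both [b < 0] and [0 < b]. *)
split => //; apply/eqP => v0.
have [x [_]] := ne ord0 true; have [y [_]] := ne ord0 false.
rewrite /halfspace/= v0 !dotv0l => b0 b0'.
by have := lt_trans b0 b0'; rewrite ltxx.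
Qed.
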